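(* The worst-case running time of Algorithm 1 (described in the context) on a system $S$ in standard form is $\mathcal{O}(|S|^4 \cdot P_{slp}(|S|^4))$, where $|S|$ is the initial number of equations of $S$.
   Context: One-sided distributivity: the equational theory over binary $+,\times$ generated by $X\times(Y+Z)=X\times Y+X\times Z$; unification is elementary. A system in standard form is a finite set of equations $X=^?Y$ ($Y\ne X$), $X=^?Y+Z$, $X=^?Z\times Y$ ($X,Y,Z$ variables). Label variables are variables occurring as left argument of $\times$. Straight-line programs (SLPs): grammars with productions $N_i\to a$ or $N_i\to N_jN_k$ ($i>j,k$) generating one string from the top nonterminal; size = number of productions; all SLPs share one global set of productions; each SLP's generated-string length is stored. $P_{slp}$ denotes the largest polynomial bounding, in terms of the size of the largest SLP involved, the running time of each SLP operation used by the algorithm: concatenation of two SLPs, equality test of generated strings, prefix test and suffix computation, and finding one pair of mismatched terminals in two SLPs with different strings. Graph $\mathcal{LD}$: nodes are the variables. A lateral edge $X\xrightarrow{\pi}Y$ is labeled by (the top nonterminal of) an SLP $\pi$ whose string is $Z_1\cdots Z_n$ of label variables and represents $X = Z_1\times(Z_2\times\cdots(Z_n\times Y))$; initially each label variable $Z$ gets one SLP $\pi_Z\to Z$ and each equation $X=^?Z\times Y$ gives an edge $X\xrightarrow{\pi_Z}Y$. Downward edges $X\to X_1$, $X\to X_2$ for each $X=^?X_1+X_2$. Relation edges from $X$ to each label variable occurring in the label of a lateral edge leaving $X$. Let $\sim_r$ be the equivalence closure of the lateral-edge relation; $\mathcal{LP}$ has the $\sim_r$-classes as vertices and an edge $[X]\to[Y]$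 iff some $U\in[X]$ has a downward edge to some $V\in[Y]$; $[X]\gtrdot_r[Y]$ iff there is such an edge. For SLPs, $\eta=\pi$ means equal generated strings, $\eta\prec\pi$ means the string of $\eta$ is a prefix of that of $\pi$, $|\eta|$ is string length, $\eta^{-1}\pi$ the remaining suffix. Rules (premises replaced by conclusions). (0) If $U=^?V$ ($U,V$ variables) and $U$ occurs elsewhere, replace $U$ by $V$ in $S$, except that if exactly one of them is a label variable, the non-label variable is replaced by the label variable; applied eagerly. (i) $U=^?U_1+U_2$, $U=^?U_3+U_4$ $\Rightarrow$ $U=^?U_1+U_2$, $U_3=^?U_1$, $U_4=^?U_2$. (ii) $X\xrightarrow{\pi}Y$, $Z\xrightarrow{\eta}Y$, $\eta=\pi$ $\Rightarrow$ $X=^?Z$, $X\xrightarrow{\pi}Y$. (iii) $X\xrightarrow{\eta}Y$, $X\xrightarrow{\pi}Z$, $\eta=\pi$ $\Rightarrow$ $Y=^?Z$, $X\xrightarrow{\pi}Z$. (iv) $X\xrightarrow{\eta}Y$, $X\xrightarrow{\pi}Z$, $\eta\prec\pi$ $\Rightarrow$ $Y\xrightarrow{\eta^{-1}\pi}Z$, $X\xrightarrow{\pi}Z$. (v) $X\xrightarrow{\eta}Y$, $X\xrightarrow{\pi}Y$, $\eta\ne\pi$ $\Rightarrow$ a pair of distinct label variables at a position where the strings differ is equated. (vi) $X\xrightarrow{\eta}Y$, $X\xrightarrow{\pi}Z$, $|\eta|<|\pi|$, $\eta\not\prec\pi$ $\Rightarrow$ a mismatching pair of label variables is equated. (vii)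 $U\xrightarrow{\eta}W$, $U=^?U_1+U_2$, $W=^?W_1+W_2$ $\Rightarrow$ $W=^?W_1+W_2$, $U_1\xrightarrow{\eta}W_1$, $U_2\xrightarrow{\eta}W_2$, $U\xrightarrow{\eta}W$. (viii) $U\xrightarrow{\eta}W$, $U=^?U_1+U_2$ $\Rightarrow$ the same conclusion with $W_1,W_2$ fresh. (ix) FAIL if $\mathcal{LP}$ or $\mathcal{LD}$ has a cycle. (x) $X\xrightarrow{\pi}Y$, $Y\xrightarrow{\eta}Z$ $\Rightarrow$ $X\xrightarrow{\pi\eta}Z$, $Y\xrightarrow{\eta}Z$, the new SLP obtained by adding one production. Algorithm 1. Step 1: build $\mathcal{LD}$, $\mathcal{LP}$, record the set $\mathcal{V}$ of label variables. Step 2: exhaustively apply (0),(i),(ii),(iii). Step 3: if a cycle is found stop with failure; if the graphs are acyclic and represent a dag-solved form, exit with success. Step 4: select an unprocessed class maximal for $\gtrdot_r$ among unprocessed classes and process it: (v) or (vi) once if applicable; then (iv) exhaustively from source nodes toward sinks; then (x) exhaustively starting from the sink of each path backward; then (viii) once; then (vii) exhaustively. Step 5: if variables of $\mathcal{V}$ were equated go to Step 1, else go to Step 2. *)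

(* Defs.v *)
Set Warnings "-notation-overridden,-ambiguous-paths".
From mathcomp Require Import all_boot all_order all_algebra.
From Stdlib Require Import Relations.
Set Implicit Arguments. Unset Strict Implicit. Unset Printing Implicit Defensive.
Import Order.TTheory GRing.Theory Num.Theory.

Definition var := nat.

(* [eqs]: (X, Y) for X =? Y;  [adds]: (X, Y, Z) for X =? Y + Z;
   [muls]: (X, Z, Y) for X =? Z * Y. *)
Record system := System {
  eqs : seq (var * var);
  adds : seq (var * var * var);
  muls : seq (var * var * var)
}.

Definition standard_form (S : system) : bool :=
  [&& uniq (eqs S), uniq (adds S), uniq (muls S) &
      all (fun e => e.2 != e.1) (eqs S)].

Definition system_size (S : system) : nat :=
  size (eqs S) + size (adds S) + size (muls S).

Definition left_args (m : seq (var * var * var)) : seq var :=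
  undup [seq e.1.2 | e <- m].

(* The nonterminal N_i is the index i of its production in the global list, so
   new productions are appended and never disturb existing nonterminals.  An
   SLP is given by its top nonterminal. *)
Inductive production := Term of var | Cat of nat & nat.
Definition grammar := seq production.

Definition grammar_wf (G : grammar) : Prop :=
  forall i j k, i < size G -> nth (Term 0) G i = Cat j k -> (j < i) && (k < i).

Definition strings (G : grammar) : seq (seq var) :=
  foldl (fun ss p => rcons ss
           match p with
           | Term a => [:: a]
           | Cat j k => nth [::] ss j ++ nth [::] ss k
           end) [::] G.

Definition str (G : grammar) (i : nat) : seq var := nth [::] (strings G) i.

Definition supports (G : grammar) : seq (seq nat) :=
  foldl (fun ss p => rcons ss
           match p with
           | Term _ => [:: size ss]
           | Cat j k => undup (size ss :: nth [::] ss j ++ nth [::] ss k)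
           end) [::] G.

(* Number of productions of the SLP with top nonterminal i, i.e. of those
   reachable from i, and not of the whole shared grammar. *)
Definition slp_size (G : grammar) (i : nat) : nat :=
  size (nth [::] (supports G) i).

(* Suffix computation guided by the stored lengths: the first d letters of
   the string of i are dropped by descending one path of the derivation tree,
   adding one production at each node where the descent goes left. *)
Fixpoint suffix_rec (fuel : nat) (G : grammar) (i d : nat) : grammar * nat :=
  if d == 0 then (G, i) else
  if fuel is f.+1 then
    match nth (Term 0) G i with
    | Term _ => (G, i)
    | Cat j k =>
        let n := size (str G j) in
        if d < n then
          let: (G', j') := suffix_rec f G j d in
          (rcons G' (Cat j' k), size G')
        else suffix_rec f G k (d - n)
    end
  else (G, i).

Definition slp_suffix (G : grammar) (i d : nat) : grammar * nat :=
  suffix_rec i.+1 G i d.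

Definition proper_prefix (s t : seq var) : bool := prefix s t && (s != t).

Definition mismatch (s t : seq var) (a b : var) : Prop :=
  exists k, [/\ k < size s, k < size t, nth 0 s k = a, nth 0 t k = b & a <> b].

(* Running times of an implementation of the SLP operations: [t_op T G i j] is
   the time spent on the SLPs i and j of G; [t_suffix T G i j] is the time
   for removing the string of i in front of that of j. *)
Record slp_times := SlpTimes {
  t_concat : grammar -> nat -> nat -> nat;
  t_equal : grammar -> nat -> nat -> nat;
  t_prefix : grammar -> nat -> nat -> nat;
  t_suffix : grammar -> nat -> nat -> nat;
  t_mismatch : grammar -> nat -> nat -> nat
}.

(* No operation is free, and every production that the suffix computation
   adds to the grammar takes time to be written. *)
Definition proper_times (T : slp_times) : Prop :=
  forall G i j,
    [/\ 0 < t_concat T G i j, 0 < t_equal T G i j, 0 < t_prefix T G i j,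
        0 < t_mismatch T G i j
      & size (slp_suffix G j (size (str G i))).1 - size G < t_suffix T G i j].

Definition slp_bound (T : slp_times) (R : archiRealFieldType) (P : {poly R}) :
    Prop :=
  forall G i j, grammar_wf G -> i < size G -> j < size G ->
    let B := (P.[(maxn (slp_size G i) (slp_size G j))%:R])%R in
    [/\ ((t_concat T G i j)%:R <= B)%R,
        ((t_equal T G i j)%:R <= B)%R,
        ((t_prefix T G i j)%:R <= B)%R,
        prefix (str G i) (str G j) -> ((t_suffix T G i j)%:R <= B)%R
      & str G i <> str G j -> ((t_mismatch T G i j)%:R <= B)%R].

(* (X, i, Y) is the lateral edge from X to Y labelled by the SLP i. *)
Definition edge := (var * nat * var)%type.

(* [pend]: equations U =? V that still have to be eliminated by [replace];
   [solved]: those already eliminated, (U, V) meaning that U was replaced by V;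
   [sums]: (X, X1, X2) for X =? X1 + X2, giving the downward edges.  All
   components but [gram] are sets, listed without order. *)
Record graph := Graph {
  pend : seq (var * var);
  solved : seq (var * var);
  sums : seq (var * var * var);
  edges : seq edge;
  gram : grammar
}.

Section Graphs.
Variable g : graph.

Definition lateral (X Y : var) : Prop := exists i, (X, i, Y) \in edges g.

Definition downward (X Y : var) : Prop :=
  exists Z, (X, Y, Z) \in sums g \/ (X, Z, Y) \in sums g.

Definition relation_edge (X Z : var) : Prop :=
  exists i Y, (X, i, Y) \in edges g /\ Z \in str (gram g) i.

Definition LD (X Y : var) : Prop :=
  [\/ lateral X Y, downward X Y | relation_edge X Y].

Definition sim_r : var -> var -> Prop := clos_refl_sym_trans var lateral.

(* The edges of LP and the relation of classes, on representatives. *)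
Definition LP (X Y : var) : Prop :=
  exists U V, [/\ sim_r X U, sim_r Y V & downward U V].

Definition cyclic : Prop :=
  exists X, clos_trans var LD X X \/ clos_trans var LP X X.

Definition sink (X : var) : Prop := forall Y, ~ lateral X Y.

(* Every equation lhs =? rhs of the working system as lhs paired with the
   variables of rhs. *)
Definition equations : seq (var * seq var) :=
  [seq (e.1, [:: e.2]) | e <- solved g ++ pend g] ++
  [seq (e.1.1, [:: e.1.2; e.2]) | e <- sums g] ++
  [seq (e.1.1, rcons (str (gram g) e.1.2) e.2) | e <- edges g].

Definition dag_solved : Prop :=
  exists s : seq (var * seq var),
    [/\ perm_eq s equations, uniq [seq e.1 | e <- s]
      & forall i j, i <= j < size s ->
          (nth (0, [::]) s i).1 \notin (nth (0, [::]) s j).2].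

End Graphs.

Definition repl (U V x : var) : var := if x == U then V else x.

Definition repl_prod (U V : var) (p : production) : production :=
  if p is Term a then Term (repl U V a) else p.

Definition repl3 (U V : var) (e : var * var * var) : var * var * var :=
  (repl U V e.1.1, repl U V e.1.2, repl U V e.2).

Definition repl_graph (U V : var) (g : graph) : graph :=
  Graph [seq (repl U V e.1, repl U V e.2) | e <- pend g]
        [seq (repl U V e.1, repl U V e.2) | e <- solved g]
        (undup [seq repl3 U V e | e <- sums g])
        (undup [seq (repl U V e.1.1, e.1.2, repl U V e.2) | e <- edges g])
        [seq repl_prod U V p | p <- gram g].

Definition orient (labels : seq var) (U V : var) : var * var :=
  if (U \in labels) && (V \notin labels) then (V, U) else (U, V).

(* In all rules the empty [pend] of the premise reflects that the replacement
   of variables is eager: no rule may be used while variable equations are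
   pending. *)

Inductive rule_i : graph -> graph -> Prop :=
| Rule_i U U1 U2 U3 U4 sv sm es G :
    (U, U1, U2) \in sm -> (U, U3, U4) \in sm ->
    (U, U1, U2) != (U, U3, U4) ->
    rule_i (Graph [::] sv sm es G)
      (Graph [:: (U3, U1); (U4, U2)] sv (rem (U, U3, U4) sm) es G).

Inductive rule_ii : graph -> graph -> Prop :=
| Rule_ii X Y Z (pi eta : nat) sv sm es G :
    (X, pi, Y) \in es -> (Z, eta, Y) \in es -> (X, pi, Y) != (Z, eta, Y) ->
    str G eta = str G pi ->
    rule_ii (Graph [::] sv sm es G)
      (Graph [:: (X, Z)] sv sm (rem (Z, eta, Y) es) G).

Inductive rule_iii : graph -> graph -> Prop :=
| Rule_iii X Y Z (pi eta : nat) sv sm es G :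
    (X, eta, Y) \in es -> (X, pi, Z) \in es -> (X, eta, Y) != (X, pi, Z) ->
    str G eta = str G pi ->
    rule_iii (Graph [::] sv sm es G)
      (Graph [:: (Y, Z)] sv sm (rem (X, eta, Y) es) G).

(* Applied at the given source X; eta and pi are the labels compared.  The
   prefix is proper because an SLP cannot generate the empty string. *)
Inductive rule_iv (X : var) : nat -> nat -> graph -> graph -> Prop :=
| Rule_iv Y Z (pi eta : nat) sv sm es G :
    (X, eta, Y) \in es -> (X, pi, Z) \in es ->
    proper_prefix (str G eta) (str G pi) ->
    let Gk := slp_suffix G pi (size (str G eta)) in
    rule_iv X eta pi (Graph [::] sv sm es G)
      (Graph [::] sv sm (undup ((Y, Gk.2, Z) :: rem (X, eta, Y) es)) Gk.1).

Inductive rule_v (X : var) : nat -> nat -> graph -> graph -> Prop :=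
| Rule_v Y (pi eta : nat) a b sv sm es G :
    (X, eta, Y) \in es -> (X, pi, Y) \in es -> str G eta <> str G pi ->
    mismatch (str G eta) (str G pi) a b ->
    rule_v X eta pi (Graph [::] sv sm es G) (Graph [:: (a, b)] sv sm es G).

Inductive rule_vi (X : var) : nat -> nat -> graph -> graph -> Prop :=
| Rule_vi Y Z (pi eta : nat) a b sv sm es G :
    (X, eta, Y) \in es -> (X, pi, Z) \in es ->
    size (str G eta) < size (str G pi) -> ~~ prefix (str G eta) (str G pi) ->
    mismatch (str G eta) (str G pi) a b ->
    rule_vi X eta pi (Graph [::] sv sm es G) (Graph [:: (a, b)] sv sm es G).

Inductive rule_vii (U : var) : graph -> graph -> Prop :=
| Rule_vii W U1 U2 W1 W2 (eta : nat) sv sm es G :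
    (U, eta, W) \in es -> (U, U1, U2) \in sm -> (W, W1, W2) \in sm ->
    (U, U1, U2) != (W, W1, W2) ->
    rule_vii U (Graph [::] sv sm es G)
      (Graph [::] sv (rem (U, U1, U2) sm)
         (undup ((U1, eta, W1) :: (U2, eta, W2) :: es)) G).

(* [old] is a list of variables that W1 and W2 have to avoid. *)
Inductive rule_viii (old : seq var) (U : var) : graph -> graph -> Prop :=
| Rule_viii W U1 U2 W1 W2 (eta : nat) sv sm es G :
    (U, eta, W) \in es -> (U, U1, U2) \in sm ->
    W1 \notin old -> W2 \notin old -> W1 != W2 ->
    rule_viii old U (Graph [::] sv sm es G)
      (Graph [::] sv ((W, W1, W2) :: rem (U, U1, U2) sm)
         (undup ((U1, eta, W1) :: (U2, eta, W2) :: es)) G).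

(* Requiring Z to be a sink is what "starting from the sink of each path
   backward" means; in an acyclic graph the exhaustive use of this form leaves
   no instance of the unrestricted rule. *)
Inductive rule_x (X : var) : nat -> nat -> graph -> graph -> Prop :=
| Rule_x Y Z (pi eta : nat) sv sm es G :
    (X, pi, Y) \in es -> (Y, eta, Z) \in es ->
    sink (Graph [::] sv sm es G) Z ->
    rule_x X pi eta (Graph [::] sv sm es G)
      (Graph [::] sv sm (undup ((X, size G, Z) :: rem (X, pi, Y) es))
         (rcons G (Cat pi eta))).

(* [Start] and [Build ms] together construct the graphs: the products ms are
   kept as equations until the variable equations have been eliminated.
   [Clash X], ..., [Distribute X] process the class of X by [rule_v] or
   [rule_vi], then [rule_iv], [rule_x], [rule_viii] and [rule_vii]; in
   [Prefixes X swept focus], [swept] are the nodes at which [rule_iv] has been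
   exhausted and [focus] is the node under treatment. *)
Inductive phase :=
| Start
| Build of seq (var * var * var)
| Simplify
| Check
| Select
| Clash of var
| Prefixes of var & seq var & option var
| Compose of var
| Introduce of var
| Distribute of var
| Revisit
| Success
| Failure.

(* [input]: the system from which the graphs are (re)built;
   [labels]: the set of label variables;
   [merged]: the equations that identified recorded label variables since the
   graphs were last built;
   [processed]: one member of each processed class. *)
Record state := State {
  input : system;
  labels : seq var;
  merged : seq (var * var);
  processed : seq var;
  ctrl : phase;
  work : graph
}.

Definition empty_graph : graph := Graph [::] [::] [::] [::] [::].

Definition init (S : system) : state :=
  State S [::] [::] [::] Start empty_graph.

Definition repl_phase (U V : var) (p : phase) : phase :=
  match p with
  | Build ms => Build (undup [seq repl3 U V e | e <- ms])
  | Prefixes X sw f => Prefixes (repl U V X) sw f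
  | _ => p
  end.

Definition replace (e : var * var) (st : state) : state :=
  let: (U, V) := orient (labels st) e.1 e.2 in
  let: Graph p sv sm es G :=
    repl_graph U V (Graph (rem e (pend (work st))) (solved (work st))
                      (sums (work st)) (edges (work st)) (gram (work st))) in
  State (input st) (undup [seq repl U V x | x <- labels st])
    (if (U \in labels st) && (V \in labels st) then (U, V) :: merged st
     else merged st)
    [seq repl U V x | x <- processed st]
    (repl_phase U V (ctrl st))
    (Graph p ((U, V) :: sv) sm es G).

Definition discard (e : var * var) (st : state) : state :=
  let: State inp L M D p (Graph pd sv sm es G) := st in
  State inp L M D p (Graph (rem e pd) sv sm es G).

Definition initial_edges (L : seq var) (ms : seq (var * var * var)) :
    seq edge :=
  [seq (e.1.1, index e.1.2 L, e.2) | e <- ms].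

(* The nodes of the graphs: a variable that has been replaced by another one
   is no longer a node. *)
Definition nodes (st : state) : seq var :=
  undup (labels st ++ [seq e.2 | e <- solved (work st)] ++
    flatten [seq [:: e.1.1; e.1.2; e.2] | e <- sums (work st)] ++
    flatten [seq [:: e.1.1; e.2] | e <- edges (work st)]).

Definition all_vars (st : state) : seq var :=
  nodes st ++ [seq e.1 | e <- solved (work st)] ++
  flatten [seq [:: e.1; e.2] | e <- eqs (input st)] ++
  flatten [seq [:: e.1.1; e.1.2; e.2] | e <- adds (input st) ++ muls (input st)].

Definition unprocessed (st : state) (X : var) : Prop :=
  X \in nodes st /\ forall Y, sim_r (work st) X Y -> Y \notin processed st.

Definition selectable (st : state) (X : var) : Prop :=
  unprocessed st X /\ forall Y, unprocessed st Y -> ~ LP (work st) Y X.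

(* "From source nodes toward sinks": X is a source of the part of the class
   of C that has not been swept yet. *)
Definition next_source (st : state) (C : var) (swept : seq var) (X : var) :
    Prop :=
  [/\ X \in nodes st, sim_r (work st) C X, X \notin swept
    & forall Y, lateral (work st) Y X -> Y \in swept].

Definition in_class (g : graph) (C : var)
    (r : var -> graph -> graph -> Prop) (g' : graph) : Prop :=
  exists2 X, sim_r g C X & r X g g'.

Definition state_size (st : state) : nat :=
  system_size (input st) + size (labels st) + size (merged st) +
  size (processed st) +
  match ctrl st with
  | Build ms => size ms
  | Prefixes _ sw _ => size sw
  | _ => 0
  end +
  size (pend (work st)) + size (solved (work st)) + size (sums (work st)) +
  size (edges (work st)) + size (gram (work st)).

(* Apart from SLP operations and the scans below, a step takes time linear in
   the current data. *)
Definition overhead (st : state) : nat := (state_size st).+1.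

(* Equality tests for all pairs of edges which may be premises of
   [rule_ii] or [rule_iii]. *)
Definition equality_scan (T : slp_times) (g : graph) : nat :=
  \sum_(e <- edges g) \sum_(f <- edges g |
      (e != f) && ((e.1.1 == f.1.1) || (e.2 == f.2)))
    t_equal T (gram g) e.1.2 f.1.2.

(* Tests for all pairs of edges which may be premises of [rule_v] or
   [rule_vi]. *)
Definition clash_scan (T : slp_times) (g : graph) : nat :=
  \sum_(e <- edges g) \sum_(f <- edges g | (e != f) && (e.1.1 == f.1.1))
    (t_equal T (gram g) e.1.2 f.1.2 + t_prefix T (gram g) e.1.2 f.1.2).

(* Tests for all pairs of edges leaving X; as [rule_iv] at X gives X
   no new outgoing edge, they are done once for all its uses at X. *)
Definition prefix_scan (T : slp_times) (g : graph) (X : var) : nat :=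
  \sum_(e <- edges g | e.1.1 == X) \sum_(f <- edges g | (e != f) && (f.1.1 == X))
    t_prefix T (gram g) e.1.2 f.1.2.

(* Traversal of the SLPs labelling the edges, which yields the relation
   edges. *)
Definition relation_scan (g : graph) : nat :=
  \sum_(e <- edges g) slp_size (gram g) e.1.2.

(* [step T st c st']: the algorithm may pass from st to st' in time c.  The
   relation covers all choices that the algorithm leaves open.  It has no
   transition from [Select] when every class is processed. *)
Inductive step (T : slp_times) : state -> nat -> state -> Prop :=

| Step_replace st e :
    e \in pend (work st) -> e.1 != e.2 ->
    step T st (overhead st) (replace e st)
| Step_trivial st e :
    e \in pend (work st) -> e.1 = e.2 ->
    step T st (overhead st) (discard e st)

| Step_start S L M D g :
    pend g = [::] ->
    let st := State S L M D Start g in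
    step T st (overhead st)
      (State S (left_args (muls S)) [::] [::] (Build (muls S))
         (Graph (eqs S) [::] (adds S) [::] [::]))
| Step_build S L M D ms g :
    pend g = [::] ->
    let st := State S L M D (Build ms) g in
    let V := left_args ms in
    step T st (overhead st)
      (State S V [::] [::] Simplify
         (Graph [::] (solved g) (sums g) (initial_edges V ms)
            [seq Term Z | Z <- V]))

| Step_i S L M D g g' :
    rule_i g g' ->
    let st := State S L M D Simplify g in
    step T st (overhead st) (State S L M D Simplify g')
| Step_ii_iii S L M D g g' :
    rule_ii g g' \/ rule_iii g g' ->
    let st := State S L M D Simplify g in
    step T st (overhead st + equality_scan T g) (State S L M D Simplify g')
| Step_simplified S L M D g :
    pend g = [::] ->
    (forall g', ~ rule_i g g' /\ ~ rule_ii g g' /\ ~ rule_iii g g') ->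
    let st := State S L M D Simplify g in
    step T st (overhead st + equality_scan T g) (State S L M D Check g)

| Step_failure S L M D g :
    cyclic g ->
    let st := State S L M D Check g in
    step T st (overhead st + relation_scan g) (State S L M D Failure g)
| Step_success S L M D g :
    ~ cyclic g -> dag_solved g ->
    let st := State S L M D Check g in
    step T st (overhead st + relation_scan g) (State S L M D Success g)
| Step_continue S L M D g :
    ~ cyclic g -> ~ dag_solved g ->
    let st := State S L M D Check g in
    step T st (overhead st + relation_scan g) (State S L M D Select g)

| Step_select S L M D g X :
    let st := State S L M D Select g in
    selectable st X ->
    step T st (overhead st) (State S L M (X :: D) (Clash X) g)
| Step_v_vi S L M D C g g' X eta pi :
    sim_r g C X -> rule_v X eta pi g g' \/ rule_vi X eta pi g g' ->
    let st := State S L M D (Clash C) g in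
    step T st (overhead st + clash_scan T g + t_mismatch T (gram g) eta pi)
      (State S L M D (Prefixes C [::] None) g')
| Step_no_clash S L M D C g :
    (forall X eta pi g', sim_r g C X ->
       ~ rule_v X eta pi g g' /\ ~ rule_vi X eta pi g g') ->
    let st := State S L M D (Clash C) g in
    step T st (overhead st + clash_scan T g)
      (State S L M D (Prefixes C [::] None) g)
| Step_open S L M D C sw g X :
    pend g = [::] ->
    let st := State S L M D (Prefixes C sw None) g in
    next_source st C sw X ->
    step T st (overhead st + prefix_scan T g X)
      (State S L M D (Prefixes C sw (Some X)) g)
| Step_iv S L M D C sw g g' X eta pi :
    rule_iv X eta pi g g' ->
    let st := State S L M D (Prefixes C sw (Some X)) g in
    step T st (overhead st + t_suffix T (gram g) eta pi)
      (State S L M D (Prefixes C sw (Some X)) g')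
| Step_close S L M D C sw g X :
    (forall eta pi g', ~ rule_iv X eta pi g g') ->
    let st := State S L M D (Prefixes C sw (Some X)) g in
    step T st (overhead st) (State S L M D (Prefixes C (X :: sw) None) g)
| Step_swept S L M D C sw g :
    pend g = [::] ->
    let st := State S L M D (Prefixes C sw None) g in
    (forall X, ~ next_source st C sw X) ->
    step T st (overhead st) (State S L M D (Compose C) g)
| Step_x S L M D C g g' X pi eta :
    sim_r g C X -> rule_x X pi eta g g' ->
    let st := State S L M D (Compose C) g in
    step T st (overhead st + t_concat T (gram g) pi eta)
      (State S L M D (Compose C) g')
| Step_composed S L M D C g :
    (forall X pi eta g', sim_r g C X -> ~ rule_x X pi eta g g') ->
    let st := State S L M D (Compose C) g in
    step T st (overhead st) (State S L M D (Introduce C) g)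
| Step_viii S L M D C g g' :
    let st := State S L M D (Introduce C) g in
    in_class g C (rule_viii (all_vars st)) g' ->
    step T st (overhead st) (State S L M D (Distribute C) g')
| Step_no_viii S L M D C g :
    let st := State S L M D (Introduce C) g in
    (forall g', ~ in_class g C (rule_viii (all_vars st)) g') ->
    step T st (overhead st) (State S L M D (Distribute C) g)
| Step_vii S L M D C g g' :
    in_class g C rule_vii g' ->
    let st := State S L M D (Distribute C) g in
    step T st (overhead st) (State S L M D (Distribute C) g')
| Step_distributed S L M D C g :
    (forall g', ~ in_class g C rule_vii g') ->
    let st := State S L M D (Distribute C) g in
    step T st (overhead st) (State S L M D Revisit g)

(* Label variables are only ever replaced by label variables, so the equations
   in M are between label variables of S. *)
| Step_restart S L M D g :
    M <> [::] ->
    let st := State S L M D Revisit g in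
    step T st (overhead st)
      (State (System (eqs S ++ M) (adds S) (muls S)) L [::] D Start g)
| Step_next S L D g :
    let st := State S L [::] D Revisit g in
    step T st (overhead st) (State S L [::] D Simplify g).

(* Finite executions, complete or not, with their total time.  As every step
   takes time at least 1, a bound on the time of all executions from a state
   also bounds the number of their steps. *)
Inductive execution (T : slp_times) : state -> nat -> state -> Prop :=
| Exec_nil st : execution T st 0 st
| Exec_step st c st' c' st'' :
    step T st c st' -> execution T st' c' st'' ->
    execution T st (c + c') st''.

(* Main.v *)
(* Call the suffix and concatenation steps (iv) and (x) light, all others heavy.

   Label variables merged during a round are equated in the input of the next
   round, so every restart lowers the number of label variables that any
   solution of the variable equations can keep apart; hence there are O(N)
   rounds for N equations.

   Within a round there are O(N) heavy steps.  They are paid for by a weighted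
   sum of the numbers of sums, of lateral edges and of pending equations, of a
   bound K on the number of unprocessed classes, and of a bound F on the number
   of nodes that are still to be swept by (iv).  Classes only merge, a class is
   selected once, and (viii), the only source of new nodes, is used once per
   class.  The exception is (v)/(vi), after which the swept nodes of a processed
   class may join the current class; but this happens once per round, because it
   merges labels and so forces a restart.

   Between two heavy steps there are at most O(N) light ones: (iv) lowers the
   out-degree of the node under treatment, (x) the number of edges that do not
   end in a sink.  So a round has O(N^2) light steps.  Each raises the height of
   the derivation trees by at most one, and a suffix computation adds at most
   one production per level, which bounds the grammar by O(N^4).

   A round thus takes O(N^3) SLP operations (the scans over pairs of edges
   dominate), of cost P(O(N^4)) each, and O(N^7) further time in O(N^2) steps.
   The latter is absorbed because P grows at least linearly: removing a letter
   from the left-leaning SLP of a^n adds about n productions. *)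
Require Import Defs.
Set Warnings "-notation-overridden,-ambiguous-paths".
From mathcomp Require Import all_boot all_order all_algebra.
From mathcomp Require Import zify lra.
From Stdlib Require Import Relations.
Set Implicit Arguments. Unset Strict Implicit. Unset Printing Implicit Defensive.
Import Order.TTheory GRing.Theory Num.Theory.

(** * Grammars *)

Lemma strings_rcons G p : strings (rcons G p) =
  rcons (strings G) match p with
                    | Term a => [:: a]
                    | Cat j k => str G j ++ str G k
                    end.
Proof. by rewrite /strings foldl_rcons. Qed.

Lemma size_strings G : size (strings G) = size G.
Proof.
by elim/last_ind: G => // G p IH; rewrite strings_rcons !size_rcons IH.
Qed.

(** Serves to show that the letters equated by (v) and (vi) are recorded label variables: no rule of
    a round adds a terminal production, and a replacement renames terminals and labels alike. *)
Definition terms (G : grammar) : seq var :=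
  flatten [seq if p is Term a then [:: a] else [::] | p <- G].

Lemma terms_cat G G' : terms (G ++ G') = terms G ++ terms G'.
Proof. by rewrite /terms map_cat flatten_cat. Qed.

Lemma str_terms G i : {subset str G i <= terms G}.
Proof.
elim/last_ind: G i => [|G p IH] i a; first by rewrite /str nth_nil.
rewrite /str strings_rcons nth_rcons size_strings -cats1 terms_cat mem_cat.
case: ltnP => [_ /IH -> //|_]; case: eqP => // _.
case: p => [c|j k]; first by rewrite /terms /= orbC => ->.
by rewrite mem_cat => /orP[] /IH ->.
Qed.

Lemma supports_rcons G p : supports (rcons G p) =
  rcons (supports G) match p with
    | Term _ => [:: size (supports G)]
    | Cat j k => undup (size (supports G) ::
                   nth [::] (supports G) j ++ nth [::] (supports G) k)
    end.
Proof. by rewrite /supports foldl_rcons. Qed.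

Lemma size_supports G : size (supports G) = size G.
Proof.
by elim/last_ind: G => // G p IH; rewrite supports_rcons !size_rcons IH.
Qed.

Lemma support_lt G i m : m \in nth [::] (supports G) i -> m < size G.
Proof.
elim/last_ind: G i => [|G p IH] i; first by rewrite nth_nil.
rewrite supports_rcons nth_rcons size_supports size_rcons.
case: ltnP => [_ /IH /ltnW //|_]; case: eqP => // _.
case: p => [c|j k]; first by rewrite inE => /eqP ->.
rewrite mem_undup inE mem_cat => /or3P[/eqP -> //||] /IH /ltnW //.
Qed.

Lemma support_uniq G i : uniq (nth [::] (supports G) i).
Proof.
elim/last_ind: G i => [|G p IH] i; first by rewrite nth_nil.
rewrite supports_rcons nth_rcons; case: ifP => // _; case: eqP => // _.
by case: p => // j k; apply: undup_uniq.
Qed.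

Lemma slp_size_le G i : slp_size G i <= size G.
Proof.
rewrite -(size_iota 0 (size G)); apply: uniq_leq_size (support_uniq G i) _.
by move=> m /support_lt; rewrite mem_iota.
Qed.

Lemma slp_size_gt0 G i : i < size G -> 0 < slp_size G i.
Proof.
elim/last_ind: G i => [//|G p IH] i; rewrite size_rcons ltnS leq_eqVlt.
rewrite /slp_size supports_rcons nth_rcons size_supports.
case: (ltnP i (size G)) => [lt_i _|le_i /orP[/eqP ->|]]; first exact: IH.
- rewrite eqxx; case: p => // j k.
  by rewrite -has_predT; apply/hasP; exists (size G);
     rewrite ?mem_undup ?mem_head.
- by [].
Qed.

(** * Heights of derivation trees and the growth caused by a suffix computation *)

Fixpoint height_le (G : grammar) (h i : nat) : bool :=
  match nth (Term 0) G i with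
  | Term _ => true
  | Cat j k => if h is h'.+1 then height_le G h' j && height_le G h' k
               else false
  end.

Lemma height_leE G h i : height_le G h i =
  match nth (Term 0) G i with
  | Term _ => true
  | Cat j k => if h is h'.+1 then height_le G h' j && height_le G h' k
               else false
  end.
Proof. by case: h. Qed.

Lemma height_leW G h h' i : h <= h' -> height_le G h i -> height_le G h' i.
Proof.
elim: h h' i => [|h IH] h' i le_h; rewrite !height_leE;
  case: (nth _ G i) => // j k.
by case: h' le_h => // h' le_h /andP[hj hk]; rewrite !(IH h').
Qed.

Lemma height_le_cat G G' h i : grammar_wf G -> i < size G ->
  height_le (G ++ G') h i = height_le G h i.
Proof.
move=> wfG; elim: h i => [|h IH] i lt_i; rewrite !height_leE nth_cat lt_i //.
case E: (nth _ G i) => [//|j k]; have /andP[lt_j lt_k] := wfG _ _ _ lt_i E.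
by rewrite !IH //; [apply: ltn_trans lt_k _|apply: ltn_trans lt_j _].
Qed.

Lemma grammar_wf_rcons G j k : grammar_wf G -> j < size G -> k < size G ->
  grammar_wf (rcons G (Cat j k)).
Proof.
move=> wfG lt_j lt_k i j' k'; rewrite size_rcons ltnS nth_rcons leq_eqVlt.
case: ltnP => [lt_i _|le_i /orP[/eqP ->|]]; first exact: wfG.
- by rewrite eqxx => -[<- <-]; rewrite lt_j lt_k.
- by [].
Qed.

(** Where the descent goes left, the left subtree is exchanged for a suffix of itself, by induction
    no higher. So the height bound survives, each level costs at most one production, and the new
    productions are concatenations without letters. *)
Lemma suffix_rec_spec fuel G i d h :
  grammar_wf G -> i < size G -> height_le G h i ->
  exists G', let r := suffix_rec fuel G i d in
    [/\ r.1 = G ++ G', grammar_wf r.1, r.2 < size r.1, height_le r.1 h r.2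
      & size G' <= h /\ terms G' = [::]].
Proof.
move=> wfG; elim: fuel i d h => [|f IH] i d h lt_i hi.
  by exists [::]; rewrite /= cats0; case: eqP.
have stop : exists G', let r := (G, i) in
    [/\ r.1 = G ++ G', grammar_wf r.1, r.2 < size r.1, height_le r.1 h r.2
      & size G' <= h /\ terms G' = [::]].
  by exists [::]; rewrite /= cats0.
rewrite /=; case: (d == 0) => //.
case E: (nth _ G i) => [//|j k]; have /andP[lt_j lt_k] := wfG _ _ _ lt_i E.
move: hi; rewrite height_leE E; case: h stop => // h _ /andP[hj hk].
have lt_jG : j < size G by apply: ltn_trans lt_i.
have lt_kG : k < size G by apply: ltn_trans lt_i.
case: ifP => _; last first.
  have [G' [-> wf' lt' h' [s' t']]] := IH k (d - size (str G j)) h lt_kG hk.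
  by exists G'; split=> //; [apply: height_leW h' | split=> //; apply: leqW].
have := IH j d h lt_jG hj; case: (suffix_rec f G j d) => G1 j1 /= [G'].
case=> eG1 wf1 lt1 h1 [s' t'].
have lt_k1 : k < size G1 by rewrite eG1 size_cat ltn_addr.
exists (rcons G' (Cat j1 k)); split.
- by rewrite eG1 rcons_cat.
- exact: grammar_wf_rcons.
- by rewrite size_rcons.
- rewrite nth_rcons ltnn eqxx -cats1 !height_le_cat // h1 /= eG1.
  by rewrite height_le_cat.
- by rewrite size_rcons -cats1 terms_cat t'.
Qed.

Lemma nth_repl_prod U V G i : i < size G ->
  nth (Term 0) [seq repl_prod U V p | p <- G] i =
  repl_prod U V (nth (Term 0) G i).
Proof. by move=> lt_i; rewrite (nth_map (Term 0)). Qed.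

Lemma grammar_wf_repl U V G :
  grammar_wf G -> grammar_wf [seq repl_prod U V p | p <- G].
Proof.
move=> wfG i j k; rewrite size_map => lt_i; rewrite nth_repl_prod //.
by case E: (nth _ G i) => [//|j' k'] [<- <-]; apply: wfG E.
Qed.

Lemma height_le_repl U V G h i : grammar_wf G -> i < size G ->
  height_le G h i -> height_le [seq repl_prod U V p | p <- G] h i.
Proof.
move=> wfG; elim: h i => [|h IH] i lt_i; rewrite !height_leE nth_repl_prod //;
  case E: (nth _ G i) => [//|j k] //=.
have /andP[lt_j lt_k] := wfG _ _ _ lt_i E.
by case/andP=> hj hk; rewrite !IH //; apply: ltn_trans lt_i.
Qed.

Lemma terms_repl U V G :
  terms [seq repl_prod U V p | p <- G] = [seq repl U V x | x <- terms G].
Proof.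
rewrite /terms map_flatten -!map_comp; congr flatten.
by apply: eq_map => -[].
Qed.

(** * Classes of nodes *)

Lemma mem_rem_neq (T : eqType) (x y : T) s : y \in s -> y != x -> y \in rem x s.
Proof.
elim: s => //= z s IH; rewrite inE => /orP[/eqP <- neq_yx|ys neq_yx].
  by rewrite (negPf neq_yx) mem_head.
by case: ifP => // _; rewrite inE IH ?orbT.
Qed.

Lemma size_rem_lt (T : eqType) (x : T) s : x \in s -> size (rem x s) < size s.
Proof. by move=> xs; rewrite size_rem //; case: s xs. Qed.

(* A pending equation already joins the classes of its two sides; this keeps
   classes from splitting between rules (ii), (iii) and the replacement. *)
Definition link (g : graph) (X Y : var) : Prop :=
  lateral g X Y \/ (X, Y) \in pend g.

Definition eqv (g : graph) : var -> var -> Prop :=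
  clos_refl_sym_trans var (link g).

Lemma eqv_refl g X : eqv g X X. Proof. exact: rst_refl. Qed.

Lemma eqv_sym g X Y : eqv g X Y -> eqv g Y X. Proof. exact: rst_sym. Qed.

Lemma eqv_trans g Y X Z : eqv g X Y -> eqv g Y Z -> eqv g X Z.
Proof. exact: rst_trans. Qed.

Lemma eqv_edge g X i Y : (X, i, Y) \in edges g -> eqv g X Y.
Proof. by move=> e; apply: rst_step; left; exists i. Qed.

Lemma eqv_pend g X Y : (X, Y) \in pend g -> eqv g X Y.
Proof. by move=> e; apply: rst_step; right. Qed.

Lemma eqv_sub g g' (f : var -> var) :
  (forall X i Y, (X, i, Y) \in edges g -> eqv g' (f X) (f Y)) ->
  (forall X Y, (X, Y) \in pend g -> eqv g' (f X) (f Y)) ->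
  forall X Y, eqv g X Y -> eqv g' (f X) (f Y).
Proof.
move=> subE subP X Y; elim=> {X Y} [X Y [[i XY]|XY]|X|X Y _ IH|X Y Z _ IH _ IH'].
- exact: subE XY.
- exact: subP.
- exact: eqv_refl.
- exact: eqv_sym.
- exact: eqv_trans IH IH'.
Qed.

Lemma sim_eqv g X Y : sim_r g X Y -> eqv g X Y.
Proof.
elim=> {X Y} [X Y [i XY]|X|X Y _ IH|X Y Z _ IH _ IH'].
- exact: eqv_edge XY.
- exact: eqv_refl.
- exact: eqv_sym.
- exact: eqv_trans IH IH'.
Qed.

Lemma eqv_sim g X Y : pend g = [::] -> eqv g X Y -> sim_r g X Y.
Proof.
move=> p0; elim=> {X Y} [X Y [XY|]|X|X Y _ IH|X Y Z _ IH _ IH'].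
- exact: rst_step.
- by rewrite p0.
- exact: rst_refl.
- exact: rst_sym.
- exact: rst_trans IH IH'.
Qed.

(** Besides the nodes this lists both sides of pending equations, which a replacement may turn into
    nodes. Repetitions are kept so that the length is a linear expression in the sizes of the
    components. *)
Definition verts (L : seq var) (g : graph) : seq var :=
  L ++ flatten [seq [:: e.1; e.2] | e <- pend g] ++
  [seq e.2 | e <- solved g] ++
  flatten [seq [:: e.1.1; e.1.2; e.2] | e <- sums g] ++
  flatten [seq [:: e.1.1; e.2] | e <- edges g].

Section Verts.
Variables (L : seq var) (g : graph).

Lemma size_verts : size (verts L g) =
  size L + 2 * size (pend g) + size (solved g) + 3 * size (sums g) +
  2 * size (edges g).
Proof.
rewrite /verts !size_cat size_map.
elim: (pend g) => [|? ? ]; elim: (sums g) => [|? ? ]; elim: (edges g) => [|? ?] /=;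
  lia.
Qed.

Lemma verts_labels X : X \in L -> X \in verts L g.
Proof. by rewrite /verts mem_cat => ->. Qed.

Lemma verts_pend e : e \in pend g -> e.1 \in verts L g /\ e.2 \in verts L g.
Proof.
move=> e_in; rewrite /verts !mem_cat; split; apply/orP; right; apply/orP; left;
  apply/flatten_mapP; exists e => //; rewrite !inE eqxx ?orbT //.
Qed.

Lemma verts_solved e : e \in solved g -> e.2 \in verts L g.
Proof.
move=> e_in; rewrite /verts !mem_cat; do 2 (apply/orP; right).
by apply/orP; left; apply: map_f.
Qed.

Lemma verts_sums e : e \in sums g ->
  [/\ e.1.1 \in verts L g, e.1.2 \in verts L g & e.2 \in verts L g].
Proof.
move=> e_in; rewrite /verts !mem_cat; split; do 3 (apply/orP; right);
  apply/orP; left; apply/flatten_mapP; exists e => //;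
  by rewrite !inE eqxx ?orbT.
Qed.

Lemma verts_edges X i Y : (X, i, Y) \in edges g ->
  X \in verts L g /\ Y \in verts L g.
Proof.
move=> e_in; rewrite /verts !mem_cat; split; do 4 (apply/orP; right);
  apply/flatten_mapP; exists (X, i, Y) => //; by rewrite !inE eqxx ?orbT.
Qed.

Lemma verts_ind (P : var -> Prop) :
  {in L, forall X, P X} ->
  (forall e, e \in pend g -> P e.1 /\ P e.2) ->
  (forall e, e \in solved g -> P e.2) ->
  (forall e, e \in sums g -> [/\ P e.1.1, P e.1.2 & P e.2]) ->
  (forall X i Y, (X, i, Y) \in edges g -> P X /\ P Y) ->
  {in verts L g, forall X, P X}.
Proof.
move=> PL Pp Ps Pm Pe X; rewrite /verts !mem_cat => /or4P[||/mapP[e e_in ->]|].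
- exact: PL.
- by case/flatten_mapP=> e /Pp[P1 P2]; rewrite !inE => /orP[] /eqP ->.
- exact: Ps.
case/orP=> /flatten_mapP[e].
- by move/Pm=> [P1 P2 P3]; rewrite !inE => /or3P[] /eqP ->.
- by case: e => [[A i] B] /Pe[P1 P2]; rewrite !inE => /orP[] /eqP ->.
Qed.

End Verts.

Lemma nodes_verts st : {subset nodes st <= verts (labels st) (work st)}.
Proof.
move=> X; rewrite /nodes mem_undup /verts !mem_cat.
by case/or4P=> ->; rewrite ?orbT.
Qed.

(** * Covers of the unprocessed classes and of the nodes still to be swept *)

Definition unvisited (g : graph) (D : seq var) (X : var) : Prop :=
  forall Y, eqv g X Y -> Y \notin D.

(** The nodes of the selected class that (iv) has yet to visit. The class counts as processed from
    its selection on, so [unvisited] does not cover them. *)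
Definition current (p : phase) (g : graph) (X : var) : Prop :=
  match p with
  | Clash C => eqv g C X
  | Prefixes C sw f => [/\ eqv g C X, X \notin sw & f <> Some X]
  | _ => False
  end.

(* [classes_le] counts classes and is insensitive to new nodes, [todo_le] counts
   nodes. *)
Definition classes_le (K : nat) (L D : seq var) (g : graph) : Prop :=
  exists2 R : seq var, size R <= K &
    forall X, X \in verts L g -> unvisited g D X ->
      exists2 r, r \in R & eqv g X r.

Definition todo_le (F : nat) (p : phase) (L D : seq var) (g : graph) : Prop :=
  exists2 Q : seq var, size Q <= F &
    forall X, X \in verts L g -> unvisited g D X \/ current p g X -> X \in Q.

Lemma classes_le_verts L D g : classes_le (size (verts L g)) L D g.
Proof. by exists (verts L g) => // X X_in _; exists X => //; apply: eqv_refl. Qed.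

Lemma todo_le_verts p L D g : todo_le (size (verts L g)) p L D g.
Proof. by exists (verts L g). Qed.

Lemma todo_leW F F' p L D g : F <= F' -> todo_le F p L D g -> todo_le F' p L D g.
Proof. by move=> leF [Q szQ cov]; exists Q => //; apply: leq_trans leF. Qed.

Lemma classes_leW K K' L D g :
  K <= K' -> classes_le K L D g -> classes_le K' L D g.
Proof. by move=> leK [Q szQ cov]; exists Q => //; apply: leq_trans leK. Qed.

Section Grow.
Variables (g g' : graph) (L L' D : seq var).
Hypothesis subE : forall X Y, eqv g X Y -> eqv g' X Y.

Lemma unvisited_grow X : unvisited g' D X -> unvisited g D X.
Proof. by move=> unX Y /subE /unX. Qed.

Lemma unvisited_eqv X Y : eqv g' X Y -> unvisited g' D X -> unvisited g' D Y.
Proof. by move=> XY unX Z YZ; apply: unX; apply: eqv_trans YZ. Qed.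

(** The old representatives still serve when classes only merge: a class without processed members
    after the change had none before, and every vertex is equivalent to an old one. *)
Lemma classes_le_grow K :
  (forall X, X \in verts L' g' -> exists2 Y, Y \in verts L g & eqv g' X Y) ->
  classes_le K L D g -> classes_le K L' D g'.
Proof.
move=> subV [R szR cov]; exists R => // X /subV[Y Y_in XY] unX.
have [r r_in Yr] := cov Y Y_in (unvisited_grow (unvisited_eqv XY unX)).
by exists r => //; apply: eqv_trans XY (subE Yr).
Qed.

Lemma todo_le_grow p p' N F :
  (forall X, X \in verts L' g' -> X \in N \/ X \in verts L g) ->
  (forall X, current p' g' X -> unvisited g D X \/ current p g X) ->
  todo_le F p L D g -> todo_le (size N + F) p' L' D g'.
Proof.
move=> subV subC [Q szQ cov]; exists (N ++ Q).
  by rewrite size_cat leq_add2l.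
move=> X /subV[X_in _|X_in act]; first by rewrite mem_cat X_in.
rewrite mem_cat (cov X) ?orbT //.
by case: act => [/unvisited_grow|/subC] //; left.
Qed.

End Grow.

(** The representative of [X] can be struck off: a vertex sharing it would be equivalent to [X],
    which is now processed. *)
Lemma classes_le_select K L D g X :
  X \in verts L g -> unvisited g D X -> classes_le K L D g ->
  exists2 K', K = K'.+1 & classes_le K' L (X :: D) g.
Proof.
move=> X_in unX [R szR cov]; have [r r_in Xr] := cov X X_in unX.
have lt_sz := size_rem_lt r_in.
case: K szR => [|K] szR; first by case: (R) szR r_in.
exists K => //; exists (rem r R); first by rewrite -ltnS (leq_trans lt_sz).
move=> Y Y_in unY.
have [r' r'_in Yr'] : exists2 r', r' \in R & eqv g Y r'.
  by apply: cov => // Z /unY; rewrite inE negb_or => /andP[].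
exists r' => //; apply: mem_rem_neq => //; apply/eqP=> eq_r.
have /unY : eqv g Y X by apply: eqv_trans Yr' _; rewrite eq_r; apply: eqv_sym.
by rewrite mem_head.
Qed.

Lemma todo_le_select F L D g X :
  unvisited g D X -> todo_le F Select L D g ->
  todo_le F (Clash X) L (X :: D) g.
Proof.
move=> unX [Q szQ cov]; exists Q => // Y Y_in act; apply: cov => //; left.
case: act => [unY Z /unY|/= XY]; first by rewrite inE negb_or => /andP[].
by move=> Z YZ; apply: unX; apply: eqv_trans YZ.
Qed.

(** [X] can be struck off: as the focus it is no longer current, and as its class contains [C \in D]
    it is not unvisited either. *)
Lemma todo_le_open F C sw X L D g :
  X \in verts L g -> eqv g C X -> X \notin sw ->
  todo_le F (Prefixes C sw None) L D g -> C \in D ->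
  exists2 F', F = F'.+1 & todo_le F' (Prefixes C sw (Some X)) L D g.
Proof.
move=> X_in CX X_sw [Q szQ cov] C_D.
have XQ : X \in Q by apply: cov => //; right; split.
have lt_sz := size_rem_lt XQ.
case: F szQ => [|F] szQ; first by case: (Q) szQ XQ.
exists F => //; exists (rem X Q).
  by rewrite -ltnS (leq_trans lt_sz).
move=> Y Y_in act; apply: mem_rem_neq.
  by apply: cov => //; case: act => [|[CY Y_sw _]]; [left|right; split].
apply/eqP=> eq_Y; case: act => [unY|[_ _]]; last by rewrite eq_Y.
by have := unY C; rewrite C_D eq_Y => /(_ (eqv_sym CX)).
Qed.

(** * Replacement of variables *)

Lemma repl_target U V : repl U V V = V.
Proof. by rewrite /repl; case: eqP. Qed.

Lemma repl_source U V : repl U V U = V.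
Proof. by rewrite /repl eqxx. Qed.

Definition subst_graph (U V : var) (e : var * var) (g : graph) : graph :=
  Graph [seq (repl U V f.1, repl U V f.2) | f <- rem e (pend g)]
        ((U, V) :: [seq (repl U V f.1, repl U V f.2) | f <- solved g])
        (undup [seq repl3 U V f | f <- sums g])
        (undup [seq (repl U V f.1.1, f.1.2, repl U V f.2) | f <- edges g])
        [seq repl_prod U V p | p <- gram g].

Lemma replaceE e st : replace e st =
  let U := (orient (labels st) e.1 e.2).1 in
  let V := (orient (labels st) e.1 e.2).2 in
  State (input st) (undup [seq repl U V x | x <- labels st])
    (if (U \in labels st) && (V \in labels st) then (U, V) :: merged st
     else merged st)
    [seq repl U V x | x <- processed st]
    (repl_phase U V (ctrl st)) (subst_graph U V e (work st)).
Proof. by rewrite /replace; case: (orient _ _ _). Qed.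

Lemma orient_cases L e :
  e = ((orient L e.1 e.2).1, (orient L e.1 e.2).2) \/
  e = ((orient L e.1 e.2).2, (orient L e.1 e.2).1).
Proof. by rewrite /orient; case: e => a b /=; case: ifP; [right|left]. Qed.

Section Subst.
Variables (g : graph) (U V : var) (e : var * var).
Hypotheses (e_in : e \in pend g) (eE : e = (U, V) \/ e = (V, U)).
Let g' := subst_graph U V e g.

Lemma subst_pend_eqv : eqv g U V.
Proof.
case: eE => eqe; move: e_in; rewrite eqe; first exact: eqv_pend.
by move/eqv_pend; apply: eqv_sym.
Qed.

Lemma repl_eqv X : eqv g X (repl U V X).
Proof.
rewrite /repl; case: eqP => [->|_]; [exact: subst_pend_eqv|exact: eqv_refl].
Qed.

(** Only the link [e] disappears, and the renaming identifies its two sides. *)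
Lemma eqv_subst_fwd X Y : eqv g X Y -> eqv g' (repl U V X) (repl U V Y).
Proof.
apply: eqv_sub => {X Y} [X i Y XY|X Y XY].
  apply: (@eqv_edge _ _ i); rewrite mem_undup; apply/mapP.
  by exists (X, i, Y).
have [eqe|neq] := eqVneq (X, Y) e.
  suff -> : repl U V X = repl U V Y by apply: eqv_refl.
  by move: eE; rewrite -eqe => -[] [-> ->]; rewrite repl_target repl_source.
by apply: eqv_pend; apply/mapP; exists (X, Y) => //; apply: mem_rem_neq.
Qed.

Lemma eqv_subst_bwd X Y : eqv g' X Y -> eqv g X Y.
Proof.
have repl2 A B : eqv g A B -> eqv g (repl U V A) (repl U V B).
  move=> AB; apply: eqv_trans (eqv_sym (repl_eqv A)) _.
  exact: eqv_trans AB (repl_eqv B).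
apply: (@eqv_sub _ _ id) => {X Y} [X i Y|X Y] /=.
  rewrite mem_undup => /mapP[[[A j] B] AB [-> _ ->]].
  exact: repl2 (eqv_edge AB).
by case/mapP=> -[A B] /mem_rem AB [-> ->]; apply: repl2 (eqv_pend AB).
Qed.

Lemma verts_subst L X : X \in verts (undup [seq repl U V x | x <- L]) g' ->
  exists2 Y, Y \in verts L g & X = repl U V Y.
Proof.
move: X; apply: verts_ind => [X|f|f|f|X i Y] /=.
- rewrite mem_undup => /mapP[Y Y_in ->]; exists Y => //; exact: verts_labels.
- case/mapP=> h /mem_rem /(verts_pend L)[h1 h2] ->.
  by split; [exists h.1|exists h.2].
- rewrite inE => /orP[/eqP -> /=|/mapP[h /(verts_solved L) h2 ->]]; last by exists h.2.
  exists V; last by rewrite repl_target.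
  by move: (verts_pend L e_in); case: eE => -> [].
- rewrite mem_undup => /mapP[h /(verts_sums L)[h1 h2 h3] ->].
  by split; [exists h.1.1|exists h.1.2|exists h.2].
- rewrite mem_undup => /mapP[[[A j] B] /(verts_edges L)[hA hB] [-> _ ->]].
  by split; [exists A|exists B].
Qed.

Lemma unvisited_subst D Y :
  unvisited g' [seq repl U V x | x <- D] (repl U V Y) -> unvisited g D Y.
Proof.
move=> unX Z YZ; apply/negP=> Z_in.
by have /negP := unX _ (eqv_subst_fwd YZ); apply; apply: map_f.
Qed.

Lemma classes_le_subst K L D : classes_le K L D g ->
  classes_le K (undup [seq repl U V x | x <- L]) [seq repl U V x | x <- D] g'.
Proof.
case=> R szR cov; exists [seq repl U V x | x <- R]; first by rewrite size_map.
move=> X /verts_subst[Y Y_in ->] /unvisited_subst unY.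
have [r r_in Yr] := cov Y Y_in unY.
by exists (repl U V r); [apply: map_f|apply: eqv_subst_fwd].
Qed.

Lemma todo_le_subst F p p' L D :
  (forall Y, current p' g' (repl U V Y) -> current p g Y) ->
  todo_le F p L D g ->
  todo_le F p' (undup [seq repl U V x | x <- L]) [seq repl U V x | x <- D] g'.
Proof.
move=> curE [Q szQ cov]; exists [seq repl U V x | x <- Q]; first by rewrite size_map.
move=> X /verts_subst[Y Y_in ->] act; apply: map_f; apply: cov => //.
by case: act => [/unvisited_subst|/curE]; [left|right].
Qed.

(** The swept list is empty here because a replacement does not rename it; [pend_ok] guarantees that
    a replacement meets no other case. *)
Lemma current_subst C Y :
  current (Prefixes (repl U V C) [::] None) g' (repl U V Y) ->
  current (Prefixes C [::] None) g Y.
Proof.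
case=> /eqv_subst_bwd CY _ _; split=> //.
apply: eqv_trans (repl_eqv C) _; apply: eqv_trans CY _.
exact: eqv_sym (repl_eqv Y).
Qed.

End Subst.

Lemma size_subst g U V e : e \in pend g -> let g' := subst_graph U V e g in
  [/\ size (pend g') < size (pend g), size (solved g') = (size (solved g)).+1,
      size (sums g') <= size (sums g) & size (edges g') <= size (edges g)].
Proof.
move=> e_in g'; split; rewrite /g' /= ?size_map //; first exact: size_rem_lt.
- by rewrite -(size_map (repl3 U V) (sums g)) size_undup.
- rewrite -(size_map (fun f => (repl U V f.1.1, f.1.2, repl U V f.2)) (edges g)).
  exact: size_undup.
Qed.

Lemma undup_repl_lt U V (L : seq var) : U \in L -> V \in L -> U != V ->
  size (undup [seq repl U V x | x <- L]) < size L.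
Proof.
move=> U_in V_in neqUV; apply: leq_ltn_trans (size_rem_lt U_in).
apply: uniq_leq_size (undup_uniq _) _ => x; rewrite mem_undup => /mapP[y y_in ->].
rewrite /repl; case: eqP => [_|/eqP]; last exact: mem_rem_neq.
by apply: mem_rem_neq; rewrite // eq_sym.
Qed.

Lemma mem_undup_repl U V (L : seq var) x : U \notin L ->
  (x \in undup [seq repl U V y | y <- L]) = (x \in L).
Proof.
move=> U_in; rewrite mem_undup.
suff -> : [seq repl U V y | y <- L] = L by [].
apply: map_id_in => y y_in; rewrite /repl.
by case: eqP => // eq_y; rewrite -eq_y y_in in U_in.
Qed.

(** * Label variables under solutions of the variable equations *)

Definition collapses (s : var -> var) (E : seq (var * var)) : Prop :=
  forall e, e \in E -> s e.1 = s e.2.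

(* The label variables of a graph built from [S] are the images of those of [S]
   under a substitution that collapses the equations of [S]. *)
Definition label_bound (S : system) (n : nat) : Prop :=
  forall s, collapses s (eqs S) ->
    size (undup [seq s x | x <- left_args (muls S)]) <= n.

(** A merge takes at least one from [size L] and adds one to [size M], so the sum stays below [n].
    By the second part, a solution of the next input takes on the label variables of [S] only values
    that it takes on [L], hence at most [n - size M] of them. *)
Definition merge_ok (n : nat) (S : system) (L : seq var) (M : seq (var * var)) :=
  size L + size M <= n /\
  forall s, collapses s (eqs S ++ M) ->
    forall x, x \in left_args (muls S) -> exists2 y, y \in L & s x = s y.

Lemma merge_ok_restart n S L M : merge_ok n S L M ->
  label_bound (System (eqs S ++ M) (adds S) (muls S)) (n - size M).
Proof.
case=> sz cov s s_ok /=; apply: leq_trans (_ : size L <= _); last by lia.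
rewrite -(size_map s L); apply: uniq_leq_size (undup_uniq _) _ => x.
rewrite mem_undup => /mapP[z /(cov s s_ok)[y y_in ->] ->].
exact: map_f.
Qed.

Lemma merge_ok_replace n S L M U V : merge_ok n S L M -> U != V ->
  ((U \in L) ==> (V \in L)) ->
  merge_ok n S (undup [seq repl U V x | x <- L])
    (if (U \in L) && (V \in L) then (U, V) :: M else M).
Proof.
move=> [sz cov] neqUV; case: ifP => [/andP[U_in V_in] _|UV imp].
  split=> [/=|s s_ok x x_in].
    by rewrite addnS -addSn (leq_trans _ sz) // leq_add2r undup_repl_lt.
  have [e|y y_in ->] := cov s _ x x_in.
    by rewrite mem_cat => e_in; apply: s_ok; rewrite mem_cat inE orbCA e_in orbT.
  exists (repl U V y); first by rewrite mem_undup; apply: map_f.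
  rewrite /repl; case: eqP => // ->.
  by apply: (s_ok (U, V)); rewrite mem_cat mem_head orbT.
have U_in : U \notin L.
  by apply/negP=> U_in; rewrite U_in (implyP imp U_in) in UV.
split=> [|s s_ok x x_in].
  apply: leq_trans sz; rewrite leq_add2r.
  by rewrite -(size_map (repl U V) L) size_undup.
by have [y y_in ->] := cov s s_ok x x_in; exists y; rewrite // mem_undup_repl.
Qed.

Lemma orient_implies L a b :
  ((orient L a b).1 \in L) ==> ((orient L a b).2 \in L).
Proof.
rewrite /orient; case: ifP => /=; first by case/andP=> _ /negPf ->.
by case: (a \in L); case: (b \in L).
Qed.

(** * The potential *)

(** The weight falls along the phases except at a selection, paid by the 18 of a class, and at the
    opening of a node, paid by the 2 of a node. The drop from 17 to 15 covers the equation created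
    by (v) or (vi); the drop from 13 to 4 covers the two edges and two nodes of (viii). *)
Definition weight (p : phase) : nat :=
  match p with
  | Simplify => 2
  | Check => 1
  | Clash _ => 17
  | Prefixes _ _ None => 15
  | Prefixes _ _ (Some _) => 16
  | Compose _ => 14
  | Introduce _ => 13
  | Distribute _ => 4
  | Revisit => 3
  | _ => 0
  end.

(* [z] holds until (v) or (vi) is used in the round; [16 * b] pays for putting
   all nodes back on the list of nodes to be swept, and the factors leave each
   rule enough to pay for what it creates and for the phase that it opens. *)
Definition rank (b K F : nat) (z : bool) (st : state) : nat :=
  18 * K + 2 * F + 5 * size (sums (work st)) + 2 * size (edges (work st)) +
  size (pend (work st)) + weight (ctrl st) + z * (16 * b).

Lemma rankE b K F z S L M D p g : rank b K F z (State S L M D p g) =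
  18 * K + 2 * F + 5 * size (sums g) + 2 * size (edges g) + size (pend g) +
  weight p + z * (16 * b).
Proof. by []. Qed.

Definition swept_size (p : phase) : nat :=
  if p is Prefixes _ sw _ then size sw else 0.

(** Quantities that grow by at most one per heavy step; bounding their sum with [H] controls the
    size of the state. *)
Definition records (st : state) : nat :=
  size (solved (work st)) + size (processed st) + swept_size (ctrl st).

Lemma recordsE S L M D p g : records (State S L M D p g) =
  size (solved g) + size D + swept_size p.
Proof. by []. Qed.

(** Measures for (iv) and (x). An edge fails to end in a sink exactly when its target is the source
    of some edge. *)
Definition light_left (st : state) : nat :=
  match ctrl st with
  | Prefixes _ _ (Some X) => count (fun f => f.1.1 == X) (edges (work st))
  | Compose _ =>
      count (fun f => f.2 \in [seq h.1.1 | h <- edges (work st)])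
        (edges (work st))
  | _ => 0
  end.

Lemma light_left_edges st : light_left st <= size (edges (work st)).
Proof.
rewrite /light_left; case: (ctrl st) => // [C sw [X|] //|C]; exact: count_size.
Qed.

(** Equations can be pending only during simplification and right after (v) or (vi), before any node
    is swept. [Start] and [Build] lie outside a round. *)
Definition pend_ok (st : state) : Prop :=
  match ctrl st with
  | Start | Build _ => False
  | Simplify | Prefixes _ [::] None => True
  | _ => pend (work st) = [::]
  end.

Definition closing (p : phase) : bool :=
  match p with
  | Prefixes _ _ _ | Compose _ | Introduce _ | Distribute _ | Revisit => true
  | _ => false
  end.

(* Once (v) or (vi) has been used, the round can only end in a restart. *)
Definition doomed (z : bool) (st : state) : Prop :=
  ~~ z -> closing (ctrl st) /\
  (merged st <> [::] \/
   exists2 e, pend (work st) = [:: e] &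
     [/\ e.1 != e.2, e.1 \in labels st & e.2 \in labels st]).

(** With a loop at the focus, (iv) could create a new edge leaving the focus, and the out-degree
    need not drop. *)
Definition focus_ok (st : state) : Prop :=
  if ctrl st is Prefixes _ _ (Some X)
  then forall i, (X, i, X) \notin edges (work st) else True.

Definition selected_ok (st : state) : Prop :=
  match ctrl st with
  | Clash C | Prefixes C _ _ => C \in processed st
  | _ => True
  end.

(** A restart appends the merged pairs to [eqs] and lowers [n] by their number, so the sum is
    preserved. *)
Definition input_ok (N n : nat) (S : system) : Prop :=
  [/\ size (eqs S) + n <= 2 * N, size (adds S) <= N & size (muls S) <= N].

(* [beta] bounds the number of light steps that remain in the round. *)
Definition gram_ok (N hmax beta : nat) (L : seq var) (g : graph) : Prop :=
  [/\ grammar_wf (gram g), {subset terms (gram g) <= L},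
      forall X i Y, (X, i, Y) \in edges g ->
        i < size (gram g) /\ height_le (gram g) (hmax - beta) i
    & size (gram g) + beta * hmax.+1 <= N + hmax * hmax.+1].

(** [n] bounds the labels and [H] the heavy steps left in the round. As each heavy step is followed
    by at most [18 * b] light ones, [H * (18 * b) + light_left st] bounds the light steps left, and
    [(18 * b) * (18 * b)] those of the whole round. *)
Record round_inv (N b n K F : nat) (z : bool) (H : nat) (st : state) : Prop :=
  RoundInv {
  ri_input : input_ok N n (input st);
  ri_rank : rank b K F z st <= H;
  ri_records : records st + H <= 17 * b;
  ri_pend : pend_ok st;
  ri_merge : merge_ok n (input st) (labels st) (merged st);
  ri_doomed : doomed z st;
  ri_classes : classes_le K (labels st) (processed st) (work st);
  ri_todo : todo_le F (ctrl st) (labels st) (processed st) (work st);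
  ri_focus : focus_ok st;
  ri_selected : selected_ok st;
  ri_gram : gram_ok N ((18 * b) * (18 * b)) (H * (18 * b) + light_left st)
              (labels st) (work st)
}.

Lemma gram_ok_mono N hmax beta beta' L g g' :
  beta' <= beta -> gram g' = gram g ->
  (forall X i Y, (X, i, Y) \in edges g' ->
     exists X' Y', (X', i, Y') \in edges g) ->
  gram_ok N hmax beta L g -> gram_ok N hmax beta' L g'.
Proof.
move=> le_b eqG subE [wf tm hE sz]; split; rewrite ?eqG //.
- move=> X i Y /subE[X' [Y' /hE[lt_i h]]]; split=> //.
  by apply: height_leW h; apply: leq_sub2l.
- by apply: leq_trans sz; rewrite leq_add2l leq_mul2r le_b orbT.
Qed.

Lemma gram_ok_subst N hmax beta L g U V e : gram_ok N hmax beta L g ->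
  gram_ok N hmax beta (undup [seq repl U V x | x <- L]) (subst_graph U V e g).
Proof.
move=> [wf tm hE sz]; split=> /=; rewrite ?size_map //.
- exact: grammar_wf_repl.
- move=> x; rewrite terms_repl mem_undup => /mapP[y /tm y_in ->].
  exact: map_f.
- move=> X i Y; rewrite mem_undup => /mapP[[[A j] B] /hE[lt_i h] [_ -> _]].
  by split=> //; apply: height_le_repl.
Qed.

(** One unit of [beta] releases [hmax.+1] productions, more than the [hmax - beta] that one descent
    can add. *)
Lemma gram_ok_suffix N hmax beta beta' L sv sm es es' G pi d :
  beta' < beta ->
  let Gk := slp_suffix G pi d in
  (exists X Y, (X, pi, Y) \in es) ->
  (forall X i Y, (X, i, Y) \in es' ->
     i = Gk.2 \/ exists X' Y', (X', i, Y') \in es) ->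
  gram_ok N hmax beta L (Graph [::] sv sm es G) ->
  gram_ok N hmax beta' L (Graph [::] sv sm es' Gk.1).
Proof.
move=> lt_b Gk [A [B AB]] subE [wf tm hE sz].
have [lt_pi h_pi] := hE _ _ _ AB.
have [G' [/= eG wf' lt' h' [s' t']]] := suffix_rec_spec pi.+1 d wf lt_pi h_pi.
rewrite -/(slp_suffix G pi d) -/Gk in eG wf' lt' h'.
have le_h : hmax - beta <= hmax - beta' by rewrite leq_sub2l // ltnW.
split=> //=.
- by move=> x; rewrite eG terms_cat t' cats0; apply: tm.
- move=> X i Y /subE[->|[X' [Y' /hE[/= lt_i h]]]].
    by split=> //; apply: height_leW h'.
  split; first by rewrite eG size_cat ltn_addr.
  by rewrite eG height_le_cat //; apply: height_leW h.
- apply: leq_trans sz => /=; rewrite eG size_cat -addnA leq_add2l.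
  have : size G' <= hmax.+1 by apply: leq_trans s' _; lia.
  move=> le_s; apply: leq_trans (leq_add le_s (leqnn _)) _.
  by rewrite -mulSn leq_mul2r lt_b orbT.
Qed.

Lemma gram_ok_concat N hmax beta beta' L sv sm es es' G pi eta :
  beta' < beta -> beta <= hmax ->
  (exists X Y, (X, pi, Y) \in es) -> (exists X Y, (X, eta, Y) \in es) ->
  (forall X i Y, (X, i, Y) \in es' ->
     i = size G \/ exists X' Y', (X', i, Y') \in es) ->
  gram_ok N hmax beta L (Graph [::] sv sm es G) ->
  gram_ok N hmax beta' L (Graph [::] sv sm es' (rcons G (Cat pi eta))).
Proof.
move=> lt_b le_b [A [B AB]] [A' [B' AB']] subE [wf tm hE sz].
have [/= lt_pi h_pi] := hE _ _ _ AB.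
have [/= lt_eta h_eta] := hE _ _ _ AB'.
have le_h : hmax - beta <= hmax - beta' by rewrite leq_sub2l // ltnW.
split=> //=.
- exact: grammar_wf_rcons.
- by move=> x; rewrite -cats1 terms_cat cats0; apply: tm.
- move=> X i Y /subE[->|[X' [Y' /hE[/= lt_i h]]]].
    rewrite size_rcons; split=> //.
    rewrite height_leE nth_rcons ltnn eqxx.
    (* By [beta <= hmax] the truncated difference really grows when [beta] drops, which makes room
       for the new level. *)
    have -> : hmax - beta' = (hmax - beta').-1.+1 by lia.
    rewrite -cats1 !height_le_cat //.
    by apply/andP; split; apply: (@height_leW _ (hmax - beta)) => //; lia.
  split; first by rewrite size_rcons ltnW.
  by rewrite -cats1 height_le_cat //; apply: height_leW h.
- apply: leq_trans sz => /=; rewrite size_rcons addSnnS leq_add2l.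
  apply: leq_trans (_ : beta'.+1 * hmax.+1 <= _).
    by rewrite mulSn addSn ltnS leq_addl.
  by rewrite leq_mul2r lt_b orbT.
Qed.

(** * Preservation of the round invariant by the steps *)

Section Round.
Variables (N b : nat).
Hypotheses (N_gt0 : 0 < N) (le_b : 200 * N <= b).

Lemma ri_edges n K F z H st : round_inv N b n K F z H st ->
  2 * size (edges (work st)) + size (pend (work st)) + size (sums (work st)) <= H.
Proof.
by case=> _ rk *; apply: leq_trans rk; rewrite /rank; move: (z * _) => w; lia.
Qed.

Lemma round_light_left n K F z H st : round_inv N b n K F z H st ->
  light_left st <= 18 * b.
Proof.
move=> I; apply: leq_trans (light_left_edges st) _.
have := ri_edges I; have := ri_records I; lia.
Qed.

Definition heavy_ok n H st : Prop :=
  exists H', H' < H /\ exists K F z, round_inv N b n K F z H' st.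

(** A strict drop of the rank lets [H] drop by one, which pays for one more record. In the grammar
    budget this releases [18 * b] light steps, enough for any new value of [light_left]. *)
Lemma heavy_step n K F z H st K' F' z' st' :
  round_inv N b n K F z H st ->
  rank b K' F' z' st' < rank b K F z st ->
  records st' <= (records st).+1 ->
  input st' = input st ->
  merge_ok n (input st) (labels st') (merged st') ->
  pend_ok st' -> doomed z' st' ->
  classes_le K' (labels st') (processed st') (work st') ->
  todo_le F' (ctrl st') (labels st') (processed st') (work st') ->
  focus_ok st' -> selected_ok st' ->
  (forall beta, gram_ok N ((18 * b) * (18 * b)) beta (labels st) (work st) ->
     gram_ok N ((18 * b) * (18 * b)) beta (labels st') (work st')) ->
  heavy_ok n H st'.
Proof.
move=> I rk rec eqI mg pd dm cl td fc sl gr.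
have rkH := ri_rank I; have recH := ri_records I.
case: H => [|H] in I rkH recH *; first by lia.
exists H; split=> //; exists K', F', z'; split=> //.
- by rewrite eqI; apply: ri_input I.
- by rewrite -ltnS; apply: leq_trans rk rkH.
- by apply: leq_trans recH; rewrite addnS -addSn leq_add2r.
- by rewrite eqI.
- apply: gram_ok_mono (gr _ (ri_gram I)) => //; last by move=> X i Y; exists X, Y.
  apply: leq_trans (leq_addr _ _).
  rewrite mulSn addnC leq_add2r; apply: leq_trans (light_left_edges st') _.
  have : 2 * size (edges (work st')) <= rank b K' F' z' st'.
    by rewrite /rank; move: (z' * _) => w; lia.
  lia.
Qed.

Lemma round_replace n K F z H st e : round_inv N b n K F z H st ->
  e \in pend (work st) -> e.1 != e.2 -> heavy_ok n H (replace e st).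
Proof.
move=> I e_in neq; rewrite replaceE /=.
set U := (orient _ _ _).1; set V := (orient _ _ _).2.
have eE : e = (U, V) \/ e = (V, U) := orient_cases (labels st) e.
have neqUV : U != V by case: eE neq => -> //=; rewrite eq_sym.
have imp : (U \in labels st) ==> (V \in labels st) := orient_implies _ _ _.
(* By [pend_ok], equations are pending in these two situations only, so no swept node needs
   renaming. *)
have shape : ctrl st = Simplify \/ exists C, ctrl st = Prefixes C [::] None.
  move: (ri_pend I) e_in; rewrite /pend_ok.
  case: (ctrl st) => [|ms||||C|C [|x sw] [X|]|C|C|C|||] //; try by move=> ->.
    by left.
  by right; exists C.
have [] := size_subst U V e_in; set g' := subst_graph U V e _ => szp szs szm sze.
have phE : weight (repl_phase U V (ctrl st)) = weight (ctrl st).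
  by case: shape => [->|[C ->]].
have swE : swept_size (repl_phase U V (ctrl st)) = swept_size (ctrl st).
  by case: shape => [->|[C ->]].
apply: (@heavy_step n K F z H st K F z) => //=.
- by rewrite rankE phE /rank; move: (z * _) => w; lia.
- by rewrite recordsE size_map swE szs !addSn.
- by apply: merge_ok_replace => //; apply: ri_merge I.
- by move: (ri_pend I); rewrite /pend_ok /=; case: shape => [->|[C ->]].
- move=> /(ri_doomed I)[cl dm] /=; split; first by case: shape cl => [->|[C ->]].
  (* Either a merge is recorded already, or [e] is the equation of the clash, whose sides are both
     labels, so that it is recorded now. *)
  left; case: dm => [mg|[f fE [f_neq f1 f2]]]; first by case: ifP.
  move: e_in; rewrite fE inE => /eqP ef; subst f.
  by case: eE => eqe; rewrite eqe /= in f1 f2; rewrite f1 f2.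
- by apply: classes_le_subst => //; apply: ri_classes I.
- apply: todo_le_subst (ri_todo I) => //.
  case: shape => [->|[C ->]] Y //; exact: current_subst.
- by case: shape => [->|[C ->]].
- move: (ri_selected I); rewrite /selected_ok /=.
  by case: shape => [->|[C ->]] //; apply: map_f.
- by move=> beta; apply: gram_ok_subst.
Qed.

Lemma round_discard n K F z H st e : round_inv N b n K F z H st ->
  e \in pend (work st) -> e.1 = e.2 -> heavy_ok n H (discard e st).
Proof.
case: st => S L M D p [pd sv sm es G] I /= e_in eqe.
have szp : @size (var * var) (rem e pd) < @size (var * var) pd by apply: size_rem_lt.
have subE X Y : eqv (Graph pd sv sm es G) X Y ->
    eqv (Graph (rem e pd) sv sm es G) X Y.
  apply: (@eqv_sub _ _ id) => {X Y} [X i Y /= XY|X Y /= XY].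
    exact: (@eqv_edge _ X i Y).
  have [eqXY|neq] := eqVneq (X, Y) e; last first.
    by apply: eqv_pend => /=; apply: mem_rem_neq.
  by move: eqe; rewrite -eqXY /= => ->; apply: eqv_refl.
have subE' X Y : eqv (Graph (rem e pd) sv sm es G) X Y ->
    eqv (Graph pd sv sm es G) X Y.
  apply: (@eqv_sub _ _ id) => {X Y} [X i Y /= XY|X Y /= /mem_rem XY].
    exact: (@eqv_edge _ X i Y).
  exact: eqv_pend.
have subV X : X \in verts L (Graph (rem e pd) sv sm es G) ->
    X \in verts L (Graph pd sv sm es G).
  move: X; apply: verts_ind => [X|f /mem_rem|f|f|X i Y] /=.
  - exact: verts_labels.
  - exact: (@verts_pend L (Graph pd sv sm es G)).
  - exact: (@verts_solved L (Graph pd sv sm es G)).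
  - exact: (@verts_sums L (Graph pd sv sm es G)).
  - exact: (@verts_edges L (Graph pd sv sm es G)).
apply: (heavy_step (K' := K) (F' := F) (z' := z) I) => //=.
- by rewrite !rankE /=; move: (z * _) => w; lia.
- exact: ri_merge I.
- move: (ri_pend I); rewrite /pend_ok /=; case: p {I} => //=.
  all: try by move=> *; subst pd.
  by move=> C [|? ?] [?|] //= ?; subst pd.
- move=> /(ri_doomed I)[cl dm] /=; split=> //.
  left; case: dm => [mg //|[f fE [f_neq f1 f2]]].
  by move: e_in f_neq; rewrite /= in fE; rewrite fE inE => /eqP <-; rewrite eqe eqxx.
- apply: classes_le_grow (ri_classes I) => //= X /subV ?.
  by exists X => //; apply: eqv_refl.
- rewrite -[F]/(size (Nil var) + F); apply: todo_le_grow (ri_todo I) => //=.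
    by move=> X /subV; right.
  move=> X cur; right; case: p cur {I} => //= [C|C sw f]; first exact: subE'.
  by case=> /subE'.
- exact: ri_focus I.
- exact: ri_selected I.
Qed.

Lemma round_phase n K F z H S L M D p g p' :
  round_inv N b n K F z H (State S L M D p g) ->
  weight p' < weight p -> swept_size p' <= (swept_size p).+1 ->
  pend_ok (State S L M D p' g) -> (~~ z -> closing p') ->
  (forall X, current p' g X -> unvisited g D X \/ current p g X) ->
  focus_ok (State S L M D p' g) -> selected_ok (State S L M D p' g) ->
  heavy_ok n H (State S L M D p' g).
Proof.
move=> I lt_w le_sw pd cl cur fc sl.
apply: (heavy_step (K' := K) (F' := F) (z' := z) I) => //.
- by rewrite !rankE; move: (z * _) => w; lia.
- by rewrite !recordsE; lia.
- exact: ri_merge I.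
- by move=> zF; have [_] := ri_doomed I zF; split=> //; apply: cl.
- exact: ri_classes I.
- rewrite -[F]/(size (Nil var) + F); apply: todo_le_grow (ri_todo I) => //=.
  by move=> X; right.
Qed.

Lemma round_next n K F z H S L D g :
  round_inv N b n K F z H (State S L [::] D Revisit g) ->
  heavy_ok n H (State S L [::] D Simplify g).
Proof.
move=> I; apply: (round_phase I) => // zF.
have [_ [//|[e]]] := ri_doomed I zF.
by have /= := ri_pend I; rewrite /pend_ok /= => ->.
Qed.

Lemma round_open n K F z H S L M D C sw g X :
  round_inv N b n K F z H (State S L M D (Prefixes C sw None) g) ->
  pend g = [::] -> next_source (State S L M D (Prefixes C sw None) g) C sw X ->
  heavy_ok n H (State S L M D (Prefixes C sw (Some X)) g).
Proof.
move=> I pd0 [/nodes_verts X_in /= CX X_sw srcs].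
have [F' eqF td] := todo_le_open X_in (sim_eqv CX) X_sw (ri_todo I) (ri_selected I).
apply: (heavy_step (K' := K) (F' := F') (z' := z) I) => //.
- by rewrite !rankE /=; move: (z * _) => w; lia.
- exact: ri_merge I.
- by rewrite /pend_ok /=; case: (sw).
- by move=> zF; have [_] := ri_doomed I zF.
- exact: ri_classes I.
- by rewrite /focus_ok /= => i; apply: contraNN X_sw => XX; apply: srcs; exists i.
- exact: ri_selected I.
Qed.

Lemma round_select n K F z H S L M D g X :
  round_inv N b n K F z H (State S L M D Select g) ->
  selectable (State S L M D Select g) X ->
  heavy_ok n H (State S L M (X :: D) (Clash X) g).
Proof.
move=> I [[/nodes_verts /= X_in unX] _].
have pd0 : pend g = [::] := ri_pend I.
have unX' : unvisited g D X by move=> Y /(eqv_sim pd0); apply: unX.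
have [K' eqK cl] := classes_le_select X_in unX' (ri_classes I).
apply: (heavy_step (K' := K') (F' := F) (z' := z) I) => //.
- by rewrite !rankE /=; move: (z * _) => w; lia.
- by rewrite !recordsE /=; lia.
- exact: ri_merge I.
- by move=> zF; have [] := ri_doomed I zF.
- exact: (todo_le_select unX' (ri_todo I)).
- exact: mem_head.
Qed.

Lemma round_clash n K F z H S L M D C g g' X eta pi :
  round_inv N b n K F z H (State S L M D (Clash C) g) ->
  rule_v X eta pi g g' \/ rule_vi X eta pi g g' ->
  heavy_ok n H (State S L M D (Prefixes C [::] None) g').
Proof.
move=> I step_v.
have : exists a b', [/\ mismatch (str (gram g) eta) (str (gram g) pi) a b',
    pend g = [::] & g' = Graph [:: (a, b')] (solved g) (sums g) (edges g) (gram g)].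
  case: step_v I => -[]; first by move=> Y pi' eta' a b' sv sm es G *; exists a, b'.
  by move=> Y Z pi' eta' a b' sv sm es G *; exists a, b'.
move=> {step_v} [a [b' [[k [lt1 lt2 ea eb neq]] pd0 ->]]].
have [wf tm hE sz] := ri_gram I.
have aL : a \in L by apply/tm/(@str_terms _ eta); rewrite -ea mem_nth.
have bL : b' \in L by apply/tm/(@str_terms _ pi); rewrite -eb mem_nth.
(* [Clash] is not a closing phase, so this is the first use of (v) or (vi) in the round. *)
have zT : z by apply/negPn/negP => /(ri_doomed I) [].
have subE Y Z : eqv g Y Z ->
    eqv (Graph [:: (a, b')] (solved g) (sums g) (edges g) (gram g)) Y Z.
  apply: (@eqv_sub _ _ id) => {Y Z} [Y i Z YZ|Y Z]; last by rewrite pd0.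
  exact: (@eqv_edge _ Y i Z).
set h := Graph _ _ _ _ _ in subE *.
(* While [z] holds, the rank reserves [16 * b] of the [17 * b]; sums, edges and solved equations
   share the remaining [b], and there are at most [2 * N] labels. *)
have szV : size (verts L h) <= 8 * b.
  rewrite size_verts /=.
  have := ri_records I; have := ri_rank I; rewrite rankE recordsE zT pd0 /=.
  have [szL _] := ri_merge I; have [szI _ _] := ri_input I; rewrite /= in szL szI.
  lia.
apply: (heavy_step (K' := K) (F' := 8 * b) (z' := false) I) => //.
- by rewrite !rankE /= zT pd0 /=; lia.
- exact: ri_merge I.
- move=> _; split=> //; right; exists (a, b') => //.
  by split=> //; apply/eqP.
- apply: classes_le_grow (ri_classes I) => // Y.
  move: Y; apply: verts_ind => /= [Y Y_in|e|e e_in|e e_in|Y i Z YZ].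
  + by exists Y; [apply: verts_labels|apply: eqv_refl].
  + rewrite inE => /eqP -> /=; split.
      by exists a; [apply: verts_labels|apply: eqv_refl].
    by exists b'; [apply: verts_labels|apply: eqv_refl].
  + by exists e.2; [apply: verts_solved|apply: eqv_refl].
  + have [? ? ?] := verts_sums L e_in.
    by split; [exists e.1.1|exists e.1.2|exists e.2]; rewrite //; apply: eqv_refl.
  + have [? ?] := verts_edges L YZ.
    by split; [exists Y|exists Z]; rewrite //; apply: eqv_refl.
- exact: todo_leW szV (todo_le_verts _ _ _ _).
- exact: ri_selected I.
Qed.

(** Common frame of (i), (ii), (iii), (vii) and (viii), which leave grammar and solved equations
    alone. The fresh nodes [W] are equivalent to old vertices, so they increase [F] but not [K]. *)
Lemma round_rewrite n K F z H S L M D p p' g g' W :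
  round_inv N b n K F z H (State S L M D p g) -> pend g = [::] ->
  rank b K (size W + F) z (State S L M D p' g') <
    rank b K F z (State S L M D p g) ->
  swept_size p' = 0 -> solved g' = solved g -> gram g' = gram g ->
  (forall X i Y, (X, i, Y) \in edges g' ->
     exists X' Y', (X', i, Y') \in edges g) ->
  (forall X i Y, (X, i, Y) \in edges g -> eqv g' X Y) ->
  (forall X, X \in verts L g' -> X \in verts L g \/
     X \in W /\ exists2 Y, Y \in verts L g & eqv g' X Y) ->
  (~~ z -> closing p') -> (forall X, ~ current p' g' X) ->
  pend_ok (State S L M D p' g') -> focus_ok (State S L M D p' g') ->
  selected_ok (State S L M D p' g') ->
  heavy_ok n H (State S L M D p' g').
Proof.
move=> I pd0 rk sw0 eqs eqG subI subE' subV cl cur pdok fc sl.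
have subE X Y : eqv g X Y -> eqv g' X Y.
  by apply: (@eqv_sub _ _ id) => // {}X {}Y; rewrite pd0.
apply: (heavy_step I rk) => //.
- by rewrite !recordsE sw0 eqs; lia.
- exact: ri_merge I.
- move=> zF; split; first exact: cl.
  by have [_ [mg|[e]]] := ri_doomed I zF; [left|rewrite pd0].
- apply: classes_le_grow (ri_classes I) => // X /subV[X_in|[_ ?]] //.
  by exists X => //; apply: eqv_refl.
- apply: todo_le_grow (ri_todo I) => //.
    by move=> X /subV[|[]]; [right|left].
  by move=> X /cur.
- by move=> beta; apply: gram_ok_mono.
Qed.

Lemma round_i n K F z H S L M D g g' :
  round_inv N b n K F z H (State S L M D Simplify g) -> rule_i g g' ->
  heavy_ok n H (State S L M D Simplify g').
Proof.
move=> I rl; case: g g' / rl I => U U1 U2 U3 U4 sv sm es G in1 in2 neq I.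
have szm : @size (var * var * var) (rem (U, U3, U4) sm) < @size (var * var * var) sm.
  exact: size_rem_lt.
set g := Graph [::] _ _ _ _ in I; set g' := Graph _ _ _ _ _.
have v1 := @verts_sums L g _ in1; have v2 := @verts_sums L g _ in2.
apply: (@round_rewrite n K F z H S L M D Simplify _ g g' [::]) => //.
- by rewrite !rankE /g /g'; move: szm (z * _) => /= szm' w; lia.
- by move=> X i Y; exists X, Y.
- by move=> X i Y XY; apply: (@eqv_edge _ X i Y).
- move=> X X_in; left; move: X X_in; apply: verts_ind => [X|e|e|e|X i Y] /=.
  + exact: verts_labels.
  + by case: v1 v2 => [? ? ?] [? ? ?]; rewrite !inE => /orP[] /eqP ->.
  + exact: (@verts_solved L g).
  + by move=> /mem_rem; apply: (@verts_sums L g).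
  + exact: (@verts_edges L g).
- by move=> zF; have [] := ri_doomed I zF.
- by move=> X [].
Qed.

(** Shared by (ii) and (iii): the ends of the removed edge stay equivalent through the remaining
    edge and the new pending equation, so no class splits. *)
Lemma round_merge n K F z H S L M D g e a b' :
  round_inv N b n K F z H (State S L M D Simplify g) ->
  pend g = [::] -> e \in edges g -> a \in verts L g -> b' \in verts L g ->
  let g' := Graph [:: (a, b')] (solved g) (sums g) (rem e (edges g)) (gram g) in
  eqv g' e.1.1 e.2 -> heavy_ok n H (State S L M D Simplify g').
Proof.
move=> I pd0 e_in aV bV g' ee.
have sze : @size edge (rem e (edges g)) < @size edge (edges g).
  exact: size_rem_lt.
apply: (@round_rewrite n K F z H S L M D Simplify _ g g' [::]) => //.
- by rewrite !rankE /g' pd0; move: sze (z * _) => /= sze' w; lia.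
- by move=> X i Y /mem_rem XY; exists X, Y.
- move=> X i Y XY; have [eqe|neq] := eqVneq (X, i, Y) e; first by move: ee; rewrite -eqe.
  by apply: (@eqv_edge _ X i Y); apply: mem_rem_neq.
- move=> X X_in; left; move: X X_in; apply: verts_ind => [X|f|f|f|X i Y] /=.
  + exact: verts_labels.
  + by rewrite inE => /eqP ->.
  + exact: verts_solved.
  + exact: verts_sums.
  + by move/mem_rem; apply: verts_edges.
- by move=> zF; have [] := ri_doomed I zF.
- by move=> X [].
Qed.

Lemma round_ii_iii n K F z H S L M D g g' :
  round_inv N b n K F z H (State S L M D Simplify g) ->
  rule_ii g g' \/ rule_iii g g' ->
  heavy_ok n H (State S L M D Simplify g').
Proof.
move=> I rl; case: rl => rl; case: g g' / rl I => X Y Z pi eta sv sm es G in1 in2 neq _ I.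
  set g := Graph _ _ _ _ _ in I.
  have [XV YV] := @verts_edges L g _ _ _ in1.
  have [ZV _] := @verts_edges L g _ _ _ in2.
  apply: (round_merge I) => //; apply: (@eqv_trans _ X).
    by apply/eqv_sym/eqv_pend; rewrite inE.
  by apply: (@eqv_edge _ X pi Y); apply: mem_rem_neq.
set g := Graph _ _ _ _ _ in I.
have [XV YV] := @verts_edges L g _ _ _ in1.
have [_ ZV] := @verts_edges L g _ _ _ in2.
apply: (round_merge I) => //; apply: (@eqv_trans _ Z).
  by apply: (@eqv_edge _ X pi Z); apply: mem_rem_neq; rewrite // eq_sym.
by apply/eqv_sym/eqv_pend; rewrite inE.
Qed.

(** The removed sum yields 5 and the two new edges cost at most 4. *)
Lemma round_vii n K F z H S L M D C g g' :
  round_inv N b n K F z H (State S L M D (Distribute C) g) ->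
  in_class g C rule_vii g' ->
  heavy_ok n H (State S L M D (Distribute C) g').
Proof.
move=> I [U _ rl]; case: g g' / rl I => W U1 U2 W1 W2 eta sv sm es G in1 in2 in3 neq I.
have szm : @size (var * var * var) (rem (U, U1, U2) sm) < @size (var * var * var) sm.
  exact: size_rem_lt.
set es' := undup _.
have sze : @size edge es' <= (@size edge es).+2 by apply: size_undup.
set g := Graph [::] _ _ _ _ in I; set g' := Graph _ _ _ _ _.
have [? v1 v2] := @verts_sums L g _ in2; have [? v3 v4] := @verts_sums L g _ in3.
apply: (@round_rewrite n K F z H S L M D (Distribute C) _ g g' [::]) => //.
- by rewrite !rankE /g /g'; move: szm sze (z * _) => /= szm' sze' w; lia.
- move=> X i Y /=; rewrite mem_undup !inE => /or3P[/eqP[_ -> _]|/eqP[_ -> _]|XY].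
  + by exists U, W.
  + by exists U, W.
  + by exists X, Y.
- by move=> X i Y XY; apply: (@eqv_edge _ X i Y); rewrite mem_undup !inE XY !orbT.
- move=> X X_in; left; move: X X_in; apply: verts_ind => [X|e|e|e|X i Y] //=.
  + exact: verts_labels.
  + exact: (@verts_solved L g).
  + by move=> /mem_rem; apply: (@verts_sums L g).
  + rewrite mem_undup !inE => /or3P[/eqP[-> _ ->]|/eqP[-> _ ->]|] //.
    exact: (@verts_edges L g).
- by move=> X [].
Qed.

Lemma round_viii n K F z H S L M D C old g g' :
  round_inv N b n K F z H (State S L M D (Introduce C) g) ->
  in_class g C (rule_viii old) g' ->
  heavy_ok n H (State S L M D (Distribute C) g').
Proof.
move=> I [U _ rl].
case: g g' / rl I => W U1 U2 W1 W2 eta sv sm es G in1 in2 _ _ _ I.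
have szm : @size (var * var * var) (rem (U, U1, U2) sm) < @size (var * var * var) sm.
  exact: size_rem_lt.
set es' := undup _.
have sze : @size edge es' <= (@size edge es).+2 by apply: size_undup.
set g := Graph [::] _ _ _ _ in I; set g' := Graph _ _ _ _ _.
have [? v1 v2] := @verts_sums L g _ in2; have [? v3] := @verts_edges L g _ _ _ in1.
(* The new edges put [W1] and [W2] into the classes of [U1] and [U2], so no class is created. *)
have v4 : W1 \in [:: W1; W2] /\ exists2 Y, Y \in verts L g & eqv g' W1 Y.
  split; first by rewrite inE eqxx.
  exists U1 => //; apply: eqv_sym; apply: (@eqv_edge _ U1 eta W1).
  by rewrite mem_undup !inE eqxx.
have v5 : W2 \in [:: W1; W2] /\ exists2 Y, Y \in verts L g & eqv g' W2 Y.
  split; first by rewrite !inE eqxx orbT.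
  exists U2 => //; apply: eqv_sym; apply: (@eqv_edge _ U2 eta W2).
  by rewrite mem_undup !inE eqxx orbT.
have szW : size [:: W1; W2] = 2 by [].
move: [:: W1; W2] szW v4 v5 => Ws szW v4 v5.
apply: (@round_rewrite n K F z H S L M D (Introduce C) _ g g' Ws) => //.
- by rewrite !rankE szW /g /g'; move: szm sze (z * _) => /= szm' sze' w; lia.
- move=> X i Y /=; rewrite mem_undup !inE => /or3P[/eqP[_ -> _]|/eqP[_ -> _]|XY].
  + by exists U, W.
  + by exists U, W.
  + by exists X, Y.
- by move=> X i Y XY; apply: (@eqv_edge _ X i Y); rewrite mem_undup !inE XY !orbT.
- apply: verts_ind => [X X_in|e|e e_in|e|X i Y] //=.
  + by left; apply: verts_labels.
  + by left; apply: (@verts_solved L g).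
  + rewrite inE => /orP[/eqP -> /=|/mem_rem/(@verts_sums L g)[? ? ?]].
      by split; [left|right|right].
    by split; left.
  + rewrite mem_undup !inE => /or3P[/eqP[-> _ ->]|/eqP[-> _ ->]|].
    * by split; [left|right].
    * by split; [left|right].
    * by case/(@verts_edges L g); split; left.
- by move=> X [].
Qed.

(** (iv) and (x) change no class and create no vertex, so [K], [F] and [H] stay and only the grammar
    budget is spent. *)
Lemma light_step n K F z H S L M D p g es G :
  round_inv N b n K F z H (State S L M D p g) -> pend g = [::] ->
  let g' := Graph [::] (solved g) (sums g) es G in
  let st' := State S L M D p g' in
  size es <= size (edges g) ->
  (forall X i Y, (X, i, Y) \in es -> eqv g X Y) ->
  (forall X i Y, (X, i, Y) \in edges g -> eqv g' X Y) ->
  (forall X i Y, (X, i, Y) \in es -> X \in verts L g /\ Y \in verts L g) ->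
  focus_ok st' ->
  gram_ok N ((18 * b) * (18 * b)) (H * (18 * b) + light_left st') L g' ->
  round_inv N b n K F z H st'.
Proof.
move=> I pd0 g' st' sze subE' subE subV fc gr.
have E X Y : eqv g X Y -> eqv g' X Y.
  by apply: (@eqv_sub _ _ id) => // {}X {}Y; rewrite pd0.
have E' X Y : eqv g' X Y -> eqv g X Y by apply: (@eqv_sub _ _ id).
have V X : X \in verts L g' -> X \in verts L g.
  move: X; apply: verts_ind => [X|e|e|e|X i Y] //=.
  - exact: verts_labels.
  - exact: verts_solved.
  - exact: verts_sums.
  - exact: subV.
case: (I) => inp rk rec pdok mg dm cl td _ sl _; split=> //.
- by apply: leq_trans rk; rewrite !rankE /= pd0; move: (z * _) => w; lia.
- by move: (pdok); rewrite /pend_ok /=; case: (p) => //= C [|? ?] [?|].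
- by move=> /dm[clo [mg'|[e]]]; [split; [|left]|rewrite /= pd0].
- apply: classes_le_grow cl => // X /V X_in.
  by exists X => //; apply: eqv_refl.
- rewrite -[F]/(size (Nil var) + F); apply: todo_le_grow td => //=.
    by move=> X /V; right.
  move=> X cur; right; case: (p) cur => //= [C|C sw f]; first exact: E'.
  by case=> /E'.
Qed.

Lemma round_beta n K F z H st : round_inv N b n K F z H st ->
  H * (18 * b) + light_left st <= (18 * b) * (18 * b).
Proof.
move=> I; apply: leq_trans (_ : H.+1 * (18 * b) <= _).
  by rewrite [H.+1 * _]mulSnr leq_add2l; apply: round_light_left I.
rewrite leq_mul2r; apply/orP; right; have := ri_records I; lia.
Qed.

Lemma round_iv n K F z H S L M D C sw g g' X eta pi :
  let st := State S L M D (Prefixes C sw (Some X)) g in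
  let st' := State S L M D (Prefixes C sw (Some X)) g' in
  round_inv N b n K F z H st -> rule_iv X eta pi g g' ->
  round_inv N b n K F z H st' /\ light_left st' < light_left st.
Proof.
move=> st st' I rl; rewrite {}/st {}/st' in I *.
case: eta pi g g' / rl I => Y Z pi eta sv sm es G in1 in2 pre Gk I.
have neq : (X, pi, Z) != (X, eta, Y).
  by apply: contraTneq pre => -[-> _]; rewrite /proper_prefix eqxx andbF.
have fc : forall i, (X, i, X) \notin es := ri_focus I.
have neqYX : Y != X by apply: contraTneq in1 => ->; apply: fc.
set es' := undup _; set g := Graph [::] _ _ es _ in I *; set g' := Graph _ _ _ _ _.
have in2' : (X, pi, Z) \in es'.
  by rewrite mem_undup inE mem_rem_neq ?orbT.
have sze : @size edge es' <= @size edge es.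
  apply: leq_trans (size_undup _) _ => /=; exact: (size_rem_lt in1).
have [XV YV] := @verts_edges L g _ _ _ in1.
have [_ ZV] := @verts_edges L g _ _ _ in2.
(* The removed edge leaves [X], the added one leaves [Y], which differs from [X]. *)
have lt_l : count (fun f : edge => f.1.1 == X) es' <
            count (fun f : edge => f.1.1 == X) es.
  apply: leq_ltn_trans (_ : count (fun f : edge => f.1.1 == X) (rem (X, eta, Y) es) < _).
    apply: leq_trans (leq_count_subseq _ (undup_subseq _)) _.
    by rewrite /= (negPf neqYX).
  by rewrite (permP (perm_to_rem in1)) /= eqxx.
split=> //; apply: (light_step I) => //.
- move=> A i B; rewrite mem_undup inE => /orP[/eqP[-> _ ->]|/mem_rem AB].
    apply: (@eqv_trans _ X).
      by apply: eqv_sym; apply: (@eqv_edge _ X eta Y).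
    exact: (@eqv_edge _ X pi Z).
  exact: (@eqv_edge _ A i B).
- move=> A i B AB; have [[-> _ ->]|neqe] := eqVneq (A, i, B) (X, eta, Y).
    apply: (@eqv_trans _ Z); first exact: (@eqv_edge _ X pi Z).
    apply: eqv_sym; apply: (@eqv_edge _ Y Gk.2 Z).
    by rewrite mem_undup mem_head.
  by apply: (@eqv_edge _ A i B); rewrite mem_undup inE mem_rem_neq ?orbT.
- move=> A i B; rewrite mem_undup inE => /orP[/eqP[-> _ ->]|/mem_rem] //.
  exact: (@verts_edges L g).
- move=> i; rewrite mem_undup inE negb_or; apply/andP; split.
    by apply/eqP=> -[eX]; rewrite eX eqxx in neqYX.
  by apply: contra (fc i); apply: mem_rem.
- apply: gram_ok_suffix (ri_gram I).
  + by rewrite ltn_add2l.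
  + by exists X, Z.
  + move=> A i B; rewrite mem_undup inE => /orP[/eqP[_ -> _]|/mem_rem]; first by left.
    by right; exists A, B.
Qed.

Lemma round_x n K F z H S L M D C g g' X pi eta :
  let st := State S L M D (Compose C) g in
  let st' := State S L M D (Compose C) g' in
  round_inv N b n K F z H st -> rule_x X pi eta g g' ->
  round_inv N b n K F z H st' /\ light_left st' < light_left st.
Proof.
move=> st st' I rl; rewrite {}/st {}/st' in I *.
case: pi eta g g' / rl I => Y Z pi eta sv sm es G in1 in2 snk I.
have snkZ i B : (Z, i, B) \notin es.
  by apply/negP=> ZB; apply: (snk B); exists i.
have neq : (Y, eta, Z) != (X, pi, Y).
  by apply: contraTneq in1 => -[<- _ eZ]; rewrite -eZ snkZ.
set es' := undup _; set g := Graph [::] _ _ es _ in I *; set g' := Graph _ _ _ _ _.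
have in2' : (Y, eta, Z) \in es'.
  by rewrite mem_undup inE mem_rem_neq ?orbT.
have sze : @size edge es' <= @size edge es.
  apply: leq_trans (size_undup _) _ => /=; exact: (size_rem_lt in1).
have [XV YV] := @verts_edges L g _ _ _ in1.
have [_ ZV] := @verts_edges L g _ _ _ in2.
(* [X] keeps an outgoing edge, so sinks stay sinks; the redirected edge, which ended in the source
   [Y], now ends in the sink [Z]. *)
have srcE : [seq h.1.1 | h <- es'] =i [seq h.1.1 | h <- es].
  move=> A; apply/mapP/mapP=> -[[[A' i] B] /= AB ->].
    move: AB; rewrite mem_undup inE => /orP[/eqP[-> _ _]|/mem_rem AB].
      by exists (X, pi, Y).
    by exists (A', i, B).
  have [[-> _ _]|neqe] := eqVneq (A', i, B) (X, pi, Y).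
    by exists (X, size G, Z); rewrite ?mem_undup ?mem_head.
  by exists (A', i, B); rewrite // mem_undup inE mem_rem_neq ?orbT.
have ZS : Z \notin [seq h.1.1 | h <- es].
  by apply/mapP=> -[[[A i] B] AB /= eZ]; move: (snkZ i B); rewrite eZ AB.
have YS : Y \in [seq h.1.1 | h <- es] by apply/mapP; exists (Y, eta, Z).
have lt_l : count (fun f : edge => f.2 \in [seq h.1.1 | h <- es']) es' <
            count (fun f : edge => f.2 \in [seq h.1.1 | h <- es]) es.
  rewrite (eq_count (a2 := fun f : edge => f.2 \in [seq h.1.1 | h <- es])); last first.
    by move=> f /=; apply: srcE.
  apply: leq_ltn_trans (_ : count (fun f : edge => f.2 \in [seq h.1.1 | h <- es])
                              (rem (X, pi, Y) es) < _).
    apply: leq_trans (leq_count_subseq _ (undup_subseq _)) _.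
    by rewrite /= (negPf ZS).
  by rewrite (permP (perm_to_rem in1)) /= YS.
split=> //; apply: (light_step I) => //.
- move=> A i B; rewrite mem_undup inE => /orP[/eqP[-> _ ->]|/mem_rem AB].
    apply: (@eqv_trans _ Y); first exact: (@eqv_edge _ X pi Y).
    exact: (@eqv_edge _ Y eta Z).
  exact: (@eqv_edge _ A i B).
- move=> A i B AB; have [[-> _ ->]|neqe] := eqVneq (A, i, B) (X, pi, Y).
    apply: (@eqv_trans _ Z).
      by apply: (@eqv_edge _ X (size G) Z); rewrite mem_undup mem_head.
    by apply: eqv_sym; apply: (@eqv_edge _ Y eta Z).
  by apply: (@eqv_edge _ A i B); rewrite mem_undup inE mem_rem_neq ?orbT.
- move=> A i B; rewrite mem_undup inE => /orP[/eqP[-> _ ->]|/mem_rem] //.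
  exact: (@verts_edges L g).
- apply: gram_ok_concat (ri_gram I).
  + by rewrite ltn_add2l.
  + exact: round_beta I.
  + by exists X, Y.
  + by exists Y, Z.
  + move=> A i B; rewrite mem_undup inE => /orP[/eqP[_ -> _]|/mem_rem]; first by left.
    by right; exists A, B.
Qed.

(** The size bound of [gram_ok] once all light steps of a round are spent; of order [N ^ 4] for [b]
    linear in [N]. *)
Definition max_gram : nat := N + (18 * b) * (18 * b) * ((18 * b) * (18 * b)).+1.

Lemma round_gram n K F z H st :
  round_inv N b n K F z H st -> size (gram (work st)) <= max_gram.
Proof. by move/ri_gram=> [_ _ _]; apply: leq_trans; apply: leq_addr. Qed.

Lemma round_state_size n K F z H st : round_inv N b n K F z H st ->
  state_size st <= 60 * b + max_gram.
Proof.
move=> I; have [szI szA szM] := ri_input I; have [szL _] := ri_merge I.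
have szG := round_gram I; have rec := ri_records I; have ed := ri_edges I.
move: rec (ri_pend I); rewrite /records /pend_ok /state_size /system_size.
by case: (ctrl st) => //= *; lia.
Qed.

(** * From a restart to the next round, and the invariant of all states *)

Record start_inv (n H : nat) (st : state) : Prop := StartInv {
  si_pend : pend (work st) = [::];
  si_input : input_ok N n (input st);
  si_bound : label_bound (input st) n;
  si_size : state_size st <= 60 * b + max_gram;
  si_rank : 18 * b <= H
}.

(* [s] is the composition of the replacements made since the restart. *)
Record build_inv (n H : nat) (ms : seq (var * var * var)) (s : var -> var)
    (st : state) : Prop := BuildInv {
  bi_input : input_ok N n (input st);
  bi_bound : label_bound (input st) n;
  bi_rank : 17 * b + size (pend (work st)) < H;
  bi_pend : size (solved (work st)) + size (pend (work st)) <= 2 * N;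
  bi_merged : size (merged st) <= size (solved (work st));
  bi_labels : size (labels st) <= N;
  bi_sums : size (sums (work st)) <= N;
  bi_muls : size ms <= N;
  bi_empty : [/\ edges (work st) = [::], gram (work st) = [::]
              & processed st = [::]];
  bi_args : left_args ms =i [seq s x | x <- left_args (muls (input st))];
  bi_eqs : forall e, e \in eqs (input st) ->
    s e.1 = s e.2 \/ (s e.1, s e.2) \in pend (work st);
  bi_fact : forall t, collapses t (eqs (input st)) ->
    (forall x, t (s x) = t x) /\ collapses t (pend (work st))
}.

Definition state_inv (n H : nat) (st : state) : Prop :=
  match ctrl st with
  | Start => start_inv n H st
  | Build ms => exists s, build_inv n H ms s st
  | _ => exists K F z, round_inv N b n K F z H st
  end.

Lemma build_state_size n H ms s st : ctrl st = Build ms ->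
  build_inv n H ms s st -> state_size st <= 60 * b + max_gram.
Proof.
move=> ct I; have [szI szA szM] := bi_input I; have [e0 G0 D0] := bi_empty I.
have := bi_pend I; have := bi_merged I; have := bi_labels I; have := bi_sums I.
have := bi_muls I; rewrite /state_size /system_size ct e0 G0 D0 /=; lia.
Qed.

Lemma inv_state_size n H st : state_inv n H st ->
  state_size st <= 60 * b + max_gram.
Proof.
rewrite /state_inv; case E: (ctrl st) => [|ms|||||||||||]; try by
  move=> [K [F [z]]]; apply: round_state_size.
  exact: si_size.
by case=> s; apply: build_state_size.
Qed.

Lemma left_args_repl U V ms :
  left_args (undup [seq repl3 U V f | f <- ms]) =i
  [seq repl U V x | x <- left_args ms].
Proof.
move=> x; rewrite mem_undup; apply/mapP/mapP=> -[f].
  rewrite mem_undup => /mapP[h h_in ->] ->; exists h.1.2 => //.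
  by rewrite mem_undup; apply: map_f.
rewrite mem_undup => /mapP[h h_in ->] ->; exists (repl3 U V h) => //.
by rewrite mem_undup; apply: map_f.
Qed.

Lemma build_replace n H ms s st e : ctrl st = Build ms ->
  build_inv n H ms s st -> e \in pend (work st) -> e.1 != e.2 ->
  exists2 H', H' < H & state_inv n H' (replace e st).
Proof.
move=> ct I e_in neq; rewrite replaceE /state_inv /= ct /=.
set U := (orient _ _ _).1; set V := (orient _ _ _).2.
have eE : e = (U, V) \/ e = (V, U) := orient_cases (labels st) e.
have [] := size_subst U V e_in; set g' := subst_graph U V e _ => szp szs szm sze.
have [e0 G0 D0] := bi_empty I.
have bp := bi_pend I; have bm := bi_merged I; have br := bi_rank I.
case: H => [|H] in I br *; first by lia.
exists H => //; exists (repl U V \o s); split=> //=.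
- exact: bi_input I.
- exact: bi_bound I.
- change (17 * b + size (pend g') < H); lia.
- change (size (solved g') + size (pend g') <= 2 * N); lia.
- change (size (if (U \in labels st) && (V \in labels st)
                 then (U, V) :: merged st else merged st) <= size (solved g')).
  by rewrite szs; case: ifP => _ //=; apply: leqW.
- apply: leq_trans (size_undup _) _; rewrite size_map; exact: bi_labels I.
- exact: leq_trans szm (bi_sums I).
- apply: leq_trans (size_undup _) _; rewrite size_map; exact: bi_muls I.
- by rewrite e0 G0 D0.
- move=> x; rewrite left_args_repl.
  apply/mapP/mapP=> -[y].
    by rewrite (bi_args I) => /mapP[w w_in ->] ->; exists w.
  by move=> y_in ->; exists (s y) => //; rewrite (bi_args I); apply: map_f.
- move=> f /(bi_eqs I)[->|sf]; first by left.
  have [eqf|neqf] := eqVneq (s f.1, s f.2) e; last first.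
    by right; apply/mapP; exists (s f.1, s f.2) => //; apply: mem_rem_neq.
  left; case: eE; rewrite -eqf => -[-> ->]; by rewrite repl_source repl_target.
- move=> t t_ok; have [ts tp] := bi_fact I t_ok.
  have tUV : t U = t V by have := tp e e_in; case: eE => -> /=.
  have tr x : t (repl U V x) = t x by rewrite /repl; case: eqP => // ->.
  split=> [x|f /mapP[h /mem_rem h_in ->]] /=; first by rewrite tr ts.
  by rewrite !tr; apply: tp.
Qed.

Lemma build_discard n H ms s st e : ctrl st = Build ms ->
  build_inv n H ms s st -> e \in pend (work st) -> e.1 = e.2 ->
  exists2 H', H' < H & state_inv n H' (discard e st).
Proof.
case: st => S L M D p [pd sv sm es G] /= -> I e_in eqe; rewrite /state_inv /=.
have szp : @size (var * var) (rem e pd) < @size (var * var) pd.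
  exact: size_rem_lt.
have bp := bi_pend I; have br := bi_rank I; rewrite /= in bp br.
case: H => [|H] in I br *; first by lia.
exists H => //; exists s; case: I => /= ? ? ? ? ? ? ? ? ? ? be bf; split=> //=.
- by move: szp => /= szp; lia.
- by move: szp => /= szp; lia.
- move=> f /be[|sf]; first by left.
  have [eqf|neqf] := eqVneq (s f.1, s f.2) e; last by right; apply: mem_rem_neq.
  by left; move: eqe; rewrite -eqf.
- by move=> t /bf[ts tp]; split=> // f /mem_rem; apply: tp.
Qed.

Lemma start_step n H S L M D g : start_inv n H (State S L M D Start g) ->
  exists2 H', H' < H & state_inv n H'
    (State S (left_args (muls S)) [::] [::] (Build (muls S))
         (Graph (eqs S) [::] (adds S) [::] [::])).
Proof.
case=> /= _ inp bd _ rk; have [szI szA szM] := inp.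
(* At most one step per variable equation precedes the round proper, for which [17 * b] remain. *)
exists (17 * b + size (eqs S)).+1; first by lia.
exists id; split=> //=; first by lia.
- by apply: leq_trans (size_undup _) _; rewrite size_map.
- by move=> x; rewrite map_id.
- by right; rewrite -surjective_pairing.
Qed.

Lemma size_initial_edges V ms : size (initial_edges V ms) = size ms.
Proof. by rewrite size_map. Qed.

Lemma terms_Term V : terms [seq Term Z | Z <- V] = V.
Proof. by rewrite /terms; elim: V => //= Z V IH; rewrite IH. Qed.

Lemma nth_Term V i : exists a, nth (Term 0) [seq Term Z | Z <- V] i = Term a.
Proof.
have [lt_i|le_i] := ltnP i (size V).
  by exists (nth 0 V i); rewrite (nth_map 0).
by exists 0; rewrite nth_default // size_map.
Qed.

Lemma build_step n H S L M D ms s g : pend g = [::] ->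
  build_inv n H ms s (State S L M D (Build ms) g) ->
  let V := left_args ms in
  exists2 H', H' < H & state_inv n H'
    (State S V [::] [::] Simplify
       (Graph [::] (solved g) (sums g) (initial_edges V ms)
          [seq Term Z | Z <- V])).
Proof.
move=> pd0 I V; have rk := bi_rank I; have bp := bi_pend I.
have bs := bi_sums I; have bm := bi_muls I.
rewrite /= pd0 /= in rk bp bs bm.
(* [16 * b] is reserved for a clash; with [K = F = 8 * N] the rest of the rank is at most
   [167 * N + 2]. Together with up to [2 * N] solved equations this fits into [17 * b], as
   [200 * N <= b]. *)
exists (16 * b + 190 * N); first by lia.
have szV : size V <= size ms.
  by apply: leq_trans (size_undup _) _; rewrite size_map.
set g' := Graph _ _ _ _ _.
have szv : size (verts V g') <= 8 * N.
  by rewrite size_verts /= size_initial_edges; lia.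
exists (8 * N), (8 * N), true; split=> //=.
- exact: bi_input I.
- by rewrite rankE /= size_initial_edges; lia.
- by rewrite /records /=; lia.
(* With nothing pending, [s] solves the input equations, so [label_bound] applies to it. *)
- have cl : collapses s (eqs S).
    by move=> e /(bi_eqs I)[//|]; rewrite /= pd0.
  split=> [|t t_ok x x_in] /=.
    rewrite addn0; apply: leq_trans (bi_bound I cl).
    apply: uniq_leq_size (undup_uniq _) _ => x.
    by rewrite (bi_args I) mem_undup.
  rewrite cats0 in t_ok; have [ts _] := bi_fact I t_ok.
  by exists (s x); rewrite ?ts // (bi_args I) map_f.
- exact: classes_leW szv (classes_le_verts _ _ _).
- exact: todo_leW szv (todo_le_verts _ _ _ _).
- split=> /=.
  + by move=> i j k _; have [a ->] := nth_Term V i.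
  + by move=> x; rewrite terms_Term.
  + move=> X i Y /mapP[f f_in [_ -> _]]; rewrite size_map index_mem.
    have -> : f.1.2 \in V by rewrite mem_undup; apply: (map_f (fun e => e.1.2)).
    split=> //; rewrite height_leE.
    by have [a ->] := nth_Term V (index f.1.2 V).
  + rewrite size_map addn0; apply: leq_add; first by lia.
    by apply: leq_mul => //; apply: leq_mul => //; lia.
Qed.

(** At least one pair was merged, so [n] drops and releases [18 * b], the budget of a whole round
    including its construction. *)
Lemma round_restart n K F z H S L M D g :
  round_inv N b n K F z H (State S L M D Revisit g) -> M <> [::] ->
  let st' := State (System (eqs S ++ M) (adds S) (muls S)) L [::] D Start g in
  let n' := n - size M in
  n' * (18 * b) + 18 * b < n * (18 * b) + H /\ state_inv n' (18 * b) st'.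
Proof.
move=> I M0 st' n'; have [szL _] := ri_merge I; rewrite /= in szL.
have pd0 : pend g = [::] := ri_pend I.
have szM : 0 < size M by case: (M) M0.
have [szI szA szm] := ri_input I; rewrite /= in szI szA szm.
split.
  apply: (@leq_ltn_trans (n * (18 * b))).
    by rewrite -mulSnr leq_mul2r; apply/orP; right; rewrite /n'; lia.
  rewrite -[X in X < _]addn0 ltn_add2l; apply: leq_trans (ri_rank I).
  by rewrite rankE /=; lia.
split=> //=.
- by split=> //=; rewrite size_cat /n'; lia.
- by apply: merge_ok_restart; apply: ri_merge I.
- have szG := round_gram I; have ed := ri_edges I; have rec := ri_records I.
  move: szG ed rec; rewrite recordsE /= => szG ed rec.
  by rewrite /state_size /system_size /= size_cat; lia.
Qed.

Lemma round_inv_inv n K F z H st : round_inv N b n K F z H st -> state_inv n H st.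
Proof.
move=> I; rewrite /state_inv; move: (ri_pend I); rewrite /pend_ok.
by case: (ctrl st) => // *; exists K, F, z.
Qed.

(** * Time of a single step and of an execution *)

Lemma sum_leq_const (I : eqType) (s : seq I) (P : pred I) (f : I -> nat) c :
  (forall x, x \in s -> P x -> f x <= c) ->
  \sum_(x <- s | P x) f x <= size s * c.
Proof.
elim: s => [|x s IH] fc; first by rewrite big_nil.
have le_s : \sum_(y <- s | P y) f y <= size s * c.
  by apply: IH => y ys; apply: fc; rewrite inE ys orbT.
rewrite big_cons /= mulSn; case: ifP => Px; last exact: leq_trans (leq_addl _ _).
by apply: leq_add => //; apply: fc; rewrite ?mem_head.
Qed.

Variables (T : slp_times) (t : nat).
Hypothesis time_le : forall G i j,
  grammar_wf G -> i < size G -> j < size G -> size G <= max_gram ->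
  [/\ t_concat T G i j <= t, t_equal T G i j <= t, t_prefix T G i j <= t,
      prefix (str G i) (str G j) -> t_suffix T G i j <= t
    & str G i <> str G j -> t_mismatch T G i j <= t].

Definition light_cost : nat := (60 * b + max_gram).+1 + t.

(** Allows a scan over pairs of edges with two operations each and a traversal of the labels; the
    [t] inside [light_cost] covers the search for a mismatch. *)
Definition heavy_cost : nat :=
  light_cost + (18 * b) * ((18 * b) * (2 * t)) + (18 * b) * max_gram.

Section Costs.
Variables (n K F : nat) (z : bool) (H : nat) (st : state).
Hypothesis I : round_inv N b n K F z H st.
Let g := work st.

Lemma edges_le : size (edges g) <= 18 * b.
Proof. by have := ri_edges I; have := ri_records I; rewrite /g; lia. Qed.

Lemma op_time i j : (exists X Y, (X, i, Y) \in edges g) ->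
  (exists X Y, (X, j, Y) \in edges g) ->
  [/\ t_concat T (gram g) i j <= t, t_equal T (gram g) i j <= t,
      t_prefix T (gram g) i j <= t,
      prefix (str (gram g) i) (str (gram g) j) ->
        t_suffix T (gram g) i j <= t
    & str (gram g) i <> str (gram g) j -> t_mismatch T (gram g) i j <= t].
Proof.
case=> [X [Y XY]] [X' [Y' XY']]; have [wf _ hE _] := ri_gram I.
have [lt_i _] := hE _ _ _ XY; have [lt_j _] := hE _ _ _ XY'.
by apply: time_le => //; apply: round_gram I.
Qed.

Lemma scan_le (P : pred edge) (Q : edge -> pred edge)
    (f : edge -> edge -> nat) :
  (forall e e', e \in edges g -> e' \in edges g -> f e e' <= 2 * t) ->
  \sum_(e <- edges g | P e) \sum_(e' <- edges g | Q e e') f e e' <=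
    (18 * b) * ((18 * b) * (2 * t)).
Proof.
move=> fE; apply: leq_trans (_ : size (edges g) * ((18 * b) * (2 * t)) <= _).
  apply: sum_leq_const => e e_in _.
  apply: leq_trans (_ : size (edges g) * (2 * t) <= _).
    by apply: sum_leq_const => e' e'_in _; apply: fE.
  by rewrite leq_mul2r edges_le orbT.
by rewrite leq_mul2r edges_le orbT.
Qed.

Lemma scan_op (e e' : edge) : e \in edges g -> e' \in edges g ->
  t_equal T (gram g) e.1.2 e'.1.2 <= t /\ t_prefix T (gram g) e.1.2 e'.1.2 <= t.
Proof.
case: e e' => [[X i] Y] [[X' j] Y'] e_in e'_in.
by have [] : _ := op_time (ex_intro _ X (ex_intro _ Y e_in))
                    (ex_intro _ X' (ex_intro _ Y' e'_in)).
Qed.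

Lemma equality_scan_le : equality_scan T g <= (18 * b) * ((18 * b) * (2 * t)).
Proof.
apply: scan_le => e e' e_in e'_in; have [eq_t _] := scan_op e_in e'_in.
by apply: leq_trans eq_t _; rewrite mul2n -addnn leq_addr.
Qed.

Lemma prefix_scan_le X :
  prefix_scan T g X <= (18 * b) * ((18 * b) * (2 * t)).
Proof.
apply: scan_le => e e' e_in e'_in; have [_ pr_t] := scan_op e_in e'_in.
by apply: leq_trans pr_t _; rewrite mul2n -addnn leq_addr.
Qed.

Lemma clash_scan_le : clash_scan T g <= (18 * b) * ((18 * b) * (2 * t)).
Proof.
apply: scan_le => e e' e_in e'_in; have [eq_t pr_t] := scan_op e_in e'_in.
by rewrite mul2n -addnn leq_add.
Qed.

Lemma relation_scan_le : relation_scan g <= (18 * b) * max_gram.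
Proof.
apply: leq_trans (_ : size (edges g) * max_gram <= _).
  apply: sum_leq_const => e _ _.
  exact: leq_trans (slp_size_le _ _) (round_gram I).
by rewrite leq_mul2r edges_le orbT.
Qed.

End Costs.

(** [n * (18 * b) + H] bounds the heavy steps of all rounds to come. *)
Definition progress (n H : nat) (st : state) (c : nat) (st' : state) : Prop :=
  (exists n' H', [/\ state_inv n' H' st', n' * (18 * b) + H' < n * (18 * b) + H
                   & c <= heavy_cost]) \/
  [/\ state_inv n H st', light_left st' < light_left st & c <= light_cost].

Lemma heavy_progress n H st c st' :
  heavy_ok n H st' -> c <= heavy_cost -> progress n H st c st'.
Proof.
move=> [H' [lt_H [K [F [z I]]]]] le_c; left; exists n, H'; split=> //.
  exact: round_inv_inv I.
by rewrite ltn_add2l.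
Qed.

Lemma heavy_progress2 n H st c st' :
  (exists2 H', H' < H & state_inv n H' st') -> c <= heavy_cost ->
  progress n H st c st'.
Proof.
move=> [H' lt_H I] le_c; left; exists n, H'; split=> //.
by rewrite ltn_add2l.
Qed.

Lemma rule_labels g g' X eta pi :
  [\/ rule_iv X eta pi g g', rule_v X eta pi g g', rule_vi X eta pi g g'
    | rule_x X eta pi g g'] ->
  (exists A B, (A, eta, B) \in edges g) /\ (exists A B, (A, pi, B) \in edges g).
Proof.
case=> -[] *; split; eexists; eexists; eassumption.
Qed.

Lemma step_progress n H st c st' :
  state_inv n H st -> step T st c st' -> progress n H st c st'.
Proof.
move=> I0 stp; have over : overhead st <= (60 * b + max_gram).+1.
  exact: inv_state_size I0.
have heavyW x : x <= t + (18 * b) * ((18 * b) * (2 * t)) + (18 * b) * max_gram ->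
    overhead st + x <= heavy_cost.
  move=> le_x; apply: leq_trans (leq_add over le_x) _.
  by rewrite /heavy_cost /light_cost !addnA.
have heavy0 : overhead st <= heavy_cost by rewrite -[overhead st]addn0 heavyW.
have heavyS x : x <= (18 * b) * ((18 * b) * (2 * t)) ->
    overhead st + x <= heavy_cost.
  move=> le_x; apply: heavyW; apply: leq_trans le_x _.
  by rewrite addnAC leq_addl.
case: st c st' / stp I0 over heavyW heavy0 heavyS.
- move=> st e e_in neq I0 _ _ heavy0 _.
  case E: (ctrl st) (I0) => [|ms|||||||||||]; rewrite /state_inv E; try by
    case=> K [F [z I]]; apply: heavy_progress => //; apply: round_replace I _ _.
    by move/si_pend=> pd0; rewrite pd0 in e_in.
  by move=> [s I]; apply: heavy_progress2 => //; apply: build_replace E I _ _.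
- move=> st e e_in eqe I0 _ _ heavy0 _.
  case E: (ctrl st) (I0) => [|ms|||||||||||]; rewrite /state_inv E; try by
    case=> K [F [z I]]; apply: heavy_progress => //; apply: round_discard I _ _.
    by move/si_pend=> pd0; rewrite pd0 in e_in.
  by move=> [s I]; apply: heavy_progress2 => //; apply: build_discard E I _ _.
- move=> S L M D g pd0 st I _ _ heavy0 _.
  by apply: heavy_progress2 heavy0; apply: start_step I.
- move=> S L M D ms g pd0 st V [s I] _ _ heavy0 _.
  by apply: heavy_progress2 heavy0; apply: build_step I.
- move=> S L M D g g' rl st [K [F [z I]]] _ _ heavy0 _.
  by apply: heavy_progress heavy0; apply: round_i I rl.
- move=> S L M D g g' rl st [K [F [z I]]] _ _ _ heavyS.
  apply: heavy_progress (heavyS _ (equality_scan_le I)).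
  exact: round_ii_iii I rl.
- move=> S L M D g pd0 _ st [K [F [z I]]] _ _ _ heavyS.
  apply: heavy_progress (heavyS _ (equality_scan_le I)).
  by apply: (round_phase I) => // zF; have [] := ri_doomed I zF.
- move=> S L M D g _ st [K [F [z I]]] _ heavyW _ _; apply: heavy_progress.
    apply: (round_phase I) => //; first exact: (ri_pend I).
    by move=> zF; have [] := ri_doomed I zF.
  by apply: heavyW; rewrite (leq_trans (relation_scan_le I)) ?leq_addl.
- move=> S L M D g _ _ st [K [F [z I]]] _ heavyW _ _; apply: heavy_progress.
    apply: (round_phase I) => //; first exact: (ri_pend I).
    by move=> zF; have [] := ri_doomed I zF.
  by apply: heavyW; rewrite (leq_trans (relation_scan_le I)) ?leq_addl.
- move=> S L M D g _ _ st [K [F [z I]]] _ heavyW _ _; apply: heavy_progress.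
    apply: (round_phase I) => //; first exact: (ri_pend I).
    by move=> zF; have [] := ri_doomed I zF.
  by apply: heavyW; rewrite (leq_trans (relation_scan_le I)) ?leq_addl.
- move=> S L M D g X st sel [K [F [z I]]] _ _ heavy0 _.
  by apply: heavy_progress heavy0; apply: round_select I sel.
- move=> S L M D C g g' X eta pi _ rl st [K [F [z I]]] _ heavyW _ _.
  apply: heavy_progress; first exact: round_clash I rl.
  rewrite -addnA; apply: heavyW; rewrite [t + _]addnC -addnA.
  apply: leq_add (clash_scan_le I) _; apply: leq_trans (leq_addr _ _).
  have [] : (exists A B, (A, eta, B) \in edges g) /\
            (exists A B, (A, pi, B) \in edges g).
    by apply: (@rule_labels g g' X); case: rl; [constructor 2|constructor 3].
  move=> l1 l2; have [_ _ _ _] := op_time I l1 l2; apply.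
  clear -rl => /=.
  (* The time bound for mismatches requires different strings: for (v) a premise, for (vi) a
     consequence of the different lengths. *)
  case: rl => -[]; first by move=> Y pi' eta' a b' sv sm es G _ _ neq _; apply: neq.
  move=> Y Z pi' eta' a b' sv sm es G _ _ lt_s _ _ /= eqs.
  by rewrite eqs ltnn in lt_s.
- move=> S L M D C g _ st [K [F [z I]]] _ _ _ heavyS.
  apply: heavy_progress (heavyS _ (clash_scan_le I)).
  apply: (round_phase I) => //=; first by move=> X [CX _ _]; right.
  exact: (ri_selected I).
- move=> S L M D C sw g X pd0 st nx [K [F [z I]]] _ _ _ heavyS.
  apply: heavy_progress (heavyS _ (prefix_scan_le I X)).
  exact: round_open I pd0 nx.
- move=> S L M D C sw g g' X eta pi rl st [K [F [z I]]] over _ _ _.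
  have [I' lt_l] := round_iv I rl.
  right; split=> //; first exact: round_inv_inv I'.
  apply: leq_add over _.
  have [l1 l2] := rule_labels (Or41 _ _ _ rl).
  have [_ _ _] := op_time I l1 l2; move=> sf _; apply: sf.
  clear -rl => /=.
  by case: rl => Y Z pi' eta' sv sm es G _ _ /andP[].
- move=> S L M D C sw g X _ st [K [F [z I]]] _ _ heavy0 _.
  apply: heavy_progress heavy0; apply: (round_phase I) => //=.
  + have := ri_pend I; by rewrite /pend_ok /=; case: (sw).
  + move=> Y [CY]; rewrite inE negb_or => /andP[neq Y_sw] _; right; split=> //.
    by move=> [eXY]; rewrite eXY eqxx in neq.
  + exact: (ri_selected I).
- move=> S L M D C sw g pd0 st _ [K [F [z I]]] _ _ heavy0 _.
  by apply: heavy_progress heavy0; apply: (round_phase I).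
- move=> S L M D C g g' X pi eta _ rl st [K [F [z I]]] over _ _ _.
  have [I' lt_l] := round_x I rl.
  right; split=> //; first exact: round_inv_inv I'.
  apply: leq_add over _.
  have [l1 l2] := rule_labels (Or44 _ _ _ rl).
  by have [] := op_time I l1 l2.
- move=> S L M D C g _ st [K [F [z I]]] _ _ heavy0 _.
  apply: heavy_progress heavy0; apply: (round_phase I) => //.
  exact: (ri_pend I).
- move=> S L M D C g g' st rl [K [F [z I]]] _ _ heavy0 _.
  by apply: heavy_progress heavy0; apply: round_viii I rl.
- move=> S L M D C g st _ [K [F [z I]]] _ _ heavy0 _.
  apply: heavy_progress heavy0; apply: (round_phase I) => //.
  exact: (ri_pend I).
- move=> S L M D C g g' rl st [K [F [z I]]] _ _ heavy0 _.
  by apply: heavy_progress heavy0; apply: round_vii I rl.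
- move=> S L M D C g _ st [K [F [z I]]] _ _ heavy0 _.
  apply: heavy_progress heavy0; apply: (round_phase I) => //.
  exact: (ri_pend I).
- move=> S L M D g M0 st [K [F [z I]]] _ _ heavy0 _.
  left; have [lt_h I'] := round_restart I M0.
  by exists (n - size M), (18 * b).
- move=> S L D g st [K [F [z I]]] _ _ heavy0 _.
  by apply: heavy_progress heavy0; apply: round_next I.
Qed.

Lemma inv_light_left n H st : state_inv n H st -> light_left st <= 18 * b.
Proof.
rewrite /state_inv; case E: (ctrl st) => [|ms|||||||||||];
  try by move=> [K [F [z]]]; apply: round_light_left.
  by rewrite /light_left E.
by rewrite /light_left E.
Qed.

(* At most [18 * b] light steps separate two consecutive heavy ones. *)
Lemma execution_cost n H st c st' : state_inv n H st -> execution T st c st' ->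
  c <= (n * (18 * b) + H) * (heavy_cost + (18 * b) * light_cost) +
       light_left st * light_cost.
Proof.
move=> I ex; elim: ex n H I => // {st c st'} st c st1 c' st' stp _ IH n H I.
case: (step_progress I stp) => [[n' [H' [I' lt_h le_c]]]|[I' lt_l le_c]].
  (* The unit given up by a heavy step pays for that step and for all light steps which the new
     state allows. *)
  apply: leq_trans (leq_addr _ _).
  apply: leq_trans (leq_add le_c (IH _ _ I')) _.
  apply: leq_trans (_ : (n' * (18 * b) + H').+1 *
                        (heavy_cost + (18 * b) * light_cost) <= _).
    rewrite [(_ + _).+1 * _]mulSn -(addnA heavy_cost) leq_add2l addnC leq_add2r leq_mul2r.
    by rewrite (inv_light_left I') orbT.
  by rewrite leq_mul2r lt_h orbT.
apply: leq_trans (leq_add le_c (IH _ _ I')) _.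
rewrite addnCA leq_add2l -mulSn.
by rewrite leq_mul2r lt_l orbT.
Qed.

End Round.

Lemma init_inv N b S : N = system_size S ->
  state_inv N b N (18 * b) (init S).
Proof.
move=> szS; rewrite /system_size in szS; split=> //=.
- by split; lia.
- move=> s _; apply: leq_trans (size_undup _) _; rewrite size_map.
  by apply: leq_trans (size_undup _) _; rewrite size_map; lia.
- by rewrite /state_size /system_size /max_gram /=; lia.
Qed.

(** * Orders of magnitude in [N] *)

Section Cost.
Variables (q N b t : nat).
Hypotheses (q_gt0 : 0 < q) (N_gt0 : 0 < N) (bE : 18 * b = q * N).

Let powN i j : i <= j -> N ^ i <= N ^ j.
Proof. by move=> le_ij; rewrite leq_pexp2l. Qed.

Lemma max_gram_le : max_gram N b <= (1 + 2 * q ^ 4) * N ^ 4.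
Proof.
have qN_gt0 : 0 < q * N by rewrite muln_gt0 q_gt0.
rewrite /max_gram bE mulnDl mul1n leq_add //; first exact: (@powN 1 4).
rewrite -(mulnA 2) -expnMn; move: (q * N) qN_gt0 => E E_gt0.
have -> : E ^ 4 = E * E * (E * E) by rewrite !expnS expn0 muln1 !mulnA.
have : E * E <= E * E * (E * E) by rewrite leq_pmull // muln_gt0 E_gt0.
by rewrite mulnS; lia.
Qed.

Let d := 4 * q + 2 + 2 * q ^ 4.

Lemma light_cost_le : light_cost N b t <= d * N ^ 4 + t.
Proof.
rewrite /light_cost leq_add2r; have := max_gram_le; have := @powN 1 4 isT.
have := @powN 0 4 isT; rewrite expn0 expn1.
have le_b : 60 * b <= 4 * (q * N) by rewrite -bE; lia.
have : 4 * (q * N) <= 4 * q * N ^ 4.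
  by rewrite mulnA leq_mul2l (@powN 1 4) ?orbT.
by rewrite /d !mulnDl; lia.
Qed.

(** There are O(N^2) heavy steps; each, with the light ones up to the next, costs O(N^6 + N^2 t). *)
Lemma total_cost_le :
  (N * (18 * b) + 18 * b) * (heavy_cost N b t + 18 * b * light_cost N b t) <=
  2 * q * (d + 2 * q * d) * N ^ 8 + 2 * q * (1 + 2 * q ^ 2 + q) * (N ^ 4 * t).
Proof.
have le_h : N * (18 * b) + 18 * b <= 2 * q * N ^ 2.
  rewrite bE -mulnn -(mulnA 2) [q * (N * N)]mulnCA.
  have : q * N <= N * (q * N) by rewrite leq_pmull.
  by lia.
have le_g : max_gram N b <= d * N ^ 4.
  apply: leq_trans max_gram_le _; rewrite leq_mul2r; apply/orP; right.
  by rewrite /d; lia.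
have le_c : heavy_cost N b t + 18 * b * light_cost N b t <=
    (d + 2 * q * d) * N ^ 6 + (1 + 2 * q ^ 2 + q) * (N ^ 2 * t).
  have le_l := light_cost_le.
  have le1 : light_cost N b t <= d * N ^ 6 + N ^ 2 * t.
    apply: leq_trans le_l _; apply: leq_add; first by rewrite leq_mul2l powN ?orbT.
    by rewrite leq_pmull // expn_gt0 N_gt0.
  have le2 : 18 * b * (18 * b * (2 * t)) <= 2 * q ^ 2 * (N ^ 2 * t).
    by rewrite bE mulnA mulnn expnMn mulnCA !mulnA.
  have le3 : 18 * b * max_gram N b <= q * d * N ^ 6.
    apply: leq_trans (leq_mul (leqnn _) le_g) _.
    rewrite bE mulnACA -expnS leq_mul2l (@powN 5 6) ?orbT //.
  have le4 : 18 * b * light_cost N b t <= q * d * N ^ 6 + q * (N ^ 2 * t).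
    apply: leq_trans (leq_mul (leqnn _) le_l) _.
    rewrite bE mulnDr leq_add //.
      by rewrite mulnACA -expnS leq_mul2l (@powN 5 6) ?orbT.
    by rewrite -mulnA leq_mul2l leq_mul2r (@powN 1 2) ?orbT.
  rewrite /heavy_cost !mulnDl mul1n -mulnA; lia.
apply: leq_trans (leq_mul le_h le_c) _; rewrite mulnDr.
rewrite [X in X + _ <= _]mulnACA -expnD leq_add2l.
by rewrite [X in X <= _]mulnACA [N ^ 2 * (N ^ 2 * t)]mulnA -expnD.
Qed.

End Cost.

(** * Growth of the polynomial *)

(** The left-leaning SLP for [n.+1] equal letters, on which removing the first letter is
    expensive. *)
Fixpoint chain (n : nat) : grammar :=
  if n is m.+1 then rcons (chain m) (Cat m 0) else [:: Term 0].

Lemma size_chain n : size (chain n) = n.+1.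
Proof. by elim: n => //= n IH; rewrite size_rcons IH. Qed.

Lemma nth_chain n i : i < n -> nth (Term 0) (chain n) i.+1 = Cat i 0.
Proof.
elim: n => // n IH; rewrite ltnS leq_eqVlt /= nth_rcons size_chain ltnS.
by case/orP=> [/eqP ->|lt_i]; [rewrite ltnn eqxx|rewrite lt_i IH].
Qed.

Lemma nth_chain0 n : nth (Term 0) (chain n) 0 = Term 0.
Proof. by elim: n => //= n IH; rewrite nth_rcons size_chain. Qed.

Lemma chain_wf n : grammar_wf (chain n).
Proof.
move=> [|i] j k; first by rewrite nth_chain0.
by rewrite size_chain ltnS => lt_i; rewrite nth_chain // => -[<- <-]; rewrite ltnS leqnn.
Qed.

Lemma str_chain n i : i <= n -> str (chain n) i = nseq i.+1 0.
Proof.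
elim: n i => [[]//|n IH] i; rewrite leq_eqVlt ltnS /str /= strings_rcons.
rewrite nth_rcons size_strings size_chain.
case/orP=> [/eqP ->|le_i]; last by rewrite ltnS le_i; apply: IH.
by rewrite ltnn eqxx !IH // -nseqD addn1.
Qed.

Lemma mem_support_chain n i m :
  i <= n -> (m \in nth [::] (supports (chain n)) i) = (m <= i).
Proof.
elim: n i => [[]//|n IH] i; first by rewrite inE leqn0.
rewrite leq_eqVlt ltnS /= supports_rcons nth_rcons size_supports size_chain.
case/orP=> [/eqP ->|le_i]; last by rewrite ltnS le_i; apply: IH.
rewrite ltnn eqxx mem_undup inE mem_cat !IH // leqn0 [RHS]leq_eqVlt ltnS.
by case: (m) => [|m']; rewrite ?orbT ?orbF.
Qed.

Lemma slp_size_chain n i : i <= n -> slp_size (chain n) i = i.+1.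
Proof.
move=> le_i; rewrite -(size_iota 0 i.+1); apply/perm_size/uniq_perm.
- exact: support_uniq.
- exact: iota_uniq.
- by move=> m; rewrite mem_support_chain // mem_iota.
Qed.

(** The descent goes left from [i] down to 1, adding a production each time, and turns right there
    because the left part has length exactly one; hence [i.-1]. *)
Lemma size_suffix_chain n i f : i <= n -> i < f ->
  size (suffix_rec f (chain n) i 1).1 = n.+1 + i.-1.
Proof.
elim: i f => [|i IH] [|f] // le_i lt_f.
  by rewrite /= nth_chain0 size_chain addn0.
rewrite /= nth_chain // (str_chain (ltnW le_i)) size_nseq ltnS.
case: i IH le_i lt_f => [|i] IH le_i lt_f /=.
  by case: f lt_f => *; rewrite /= size_chain addn0.
case E: (suffix_rec f _ _ _) => [G' j'] /=.
by rewrite size_rcons -[G']/((G', j').1) -E IH ?addnS // ltnW.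
Qed.

Local Open Scope ring_scope.

(** Removing one letter from a chain of [n] productions takes positive time, and at least [n - 1]
    since every added production must be written; the factor 2 makes up for the missing one. *)
Lemma slp_bound_linear (T : slp_times) (R : archiRealFieldType) (P : {poly R}) :
  proper_times T -> slp_bound T P ->
  forall n : nat, (0 < n)%N -> n%:R <= 2 * P.[n%:R].
Proof.
move=> T_proper T_bound [//|n] _.
have [] := T_bound (chain n) 0%N n (@chain_wf n); rewrite ?size_chain //.
rewrite !slp_size_chain // (maxn_idPr _) // !str_chain // => _ _ _ suf _.
have {suf} le_t : ((t_suffix T (chain n) 0 n)%:R <= P.[n.+1%:R]).
  by apply: suf; rewrite /= ?eqxx ?prefix0s.
have [_ _ _ _] := T_proper (chain n) 0%N n.
rewrite str_chain // size_suffix_chain // size_chain addKn => lt_t.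
apply: le_trans (_ : 2 * (t_suffix T (chain n) 0 n)%:R <= _); last first.
  by rewrite ler_pM2l.
rewrite -natrM ler_nat; lia.
Qed.

(* Both sides are compared with the power [d = deg P] of [n]; the linear lower
   bound is only needed for the sign of the leading coefficient and for small
   [n]. *)
Lemma poly_scale (R : archiRealFieldType) (P : {poly R}) :
  (forall n : nat, (0 < n)%N -> n%:R <= 2 * P.[n%:R]) ->
  forall k : nat, exists2 C : R, 0 <= C &
    forall m n : nat, (0 < m)%N -> (0 < n)%N -> (m <= k * n)%N ->
      P.[m%:R] <= C * P.[n%:R].
Proof.
move=> linP k.
have natge1 n : (0 < n)%N -> 1 <= n%:R :> R by move=> ?; rewrite ler1n.
have posP n : (0 < n)%N -> 1 <= 2 * P.[n%:R].
  by move=> n_gt0; apply: le_trans (linP n n_gt0); apply: natge1.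
have P_neq0 : P != 0.
  by apply: contraTneq (posP 1%N isT) => ->; rewrite horner0 mulr0 ler10.
set d := (size P).-1; have szP : size P = d.+1.
  by rewrite prednK // lt0n size_poly_eq0.
set lc := lead_coef P; pose A := \sum_(i < d.+1) `|P`_i|.
have A_ge0 : 0 <= A by apply: sumr_ge0.
have upper x : 1 <= x -> P.[x] <= A * x ^+ d.
  move=> x_ge1; have x_ge0 : 0 <= x by apply: le_trans x_ge1.
  rewrite horner_coef szP mulr_suml; apply: ler_sum => i _.
  apply: le_trans (_ : `|P`_i| * x ^+ i <= _).
    by rewrite ler_wpM2r ?exprn_ge0 // ler_norm.
  by rewrite ler_wpM2l // ler_weXn2l // -ltnS ltn_ord.
(* After multiplication by [x] the lower terms have degree at most [d], and the case [d = 0] needs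
   no special care. *)
have lower x : 1 <= x -> `|x * P.[x] - lc * x ^+ d.+1| <= A * x ^+ d.
  move=> x_ge1; have x_ge0 : 0 <= x by apply: le_trans x_ge1.
  rewrite horner_coef szP big_ord_recr /= mulrDr [x * (_ * _)]mulrCA -exprS.
  rewrite /lc lead_coefE -/d addrK mulr_sumr /A big_ord_recr /= mulrDl.
  apply: le_trans (ler_norm_sum _ _ _) _.
  rewrite -[X in X <= _]addr0 lerD ?mulr_ge0 ?exprn_ge0 //.
  rewrite mulr_suml; apply: ler_sum => i _.
  rewrite mulrCA -exprS normrM ler_wpM2l // ger0_norm ?exprn_ge0 //.
  by rewrite ler_weXn2l.
have lc_neq0 : lc != 0 by rewrite lead_coef_eq0.
have lc_gt0 : 0 < lc.
  rewrite lt_neqAle eq_sym lc_neq0 /= leNgt; apply/negP => lc_lt0.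
  (* At this point a negative leading term would outweigh all others, contradicting [posP]. *)
  pose n := (Num.truncn (A / - lc)).+1.
  have n_gt : A < n%:R * - lc.
    by rewrite -ltr_pdivrMr ?oppr_gt0 // truncnS_gt.
  have := lower n%:R (natge1 n isT); have := posP n isT.
  have := natge1 n isT; rewrite ler_norml exprS => n_ge1 P_ge /andP[_].
  have : 0 < n%:R ^+ d :> R by rewrite exprn_gt0 // ltr0n.
  move: n%:R n_ge1 P_ge n_gt => x x_ge1 P_ge n_gt.
  move: (x ^+ d) P.[x] P_ge => y p P_ge y_gt0 le_xp.
  have : (A + lc * x) * y < 0 by rewrite pmulr_llt0 //; lra.
  have : 0 < x * p by rewrite mulr_gt0 //; lra.
  lra.
(* From [X] on the error [A * x ^+ d] is at most half the leading term; below [X] the power is at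
   most [X ^+ d], and [2 * P.[x] >= 1]. The summands of [c] serve these two cases. *)
pose X := 2 * A / lc; have X_ge0 : 0 <= X by rewrite !mulr_ge0 // invr_ge0 ltW.
pose c := 2 / lc + 2 * X ^+ d.
have c_ge0 : 0 <= c.
  by rewrite addr_ge0 ?mulr_ge0 ?exprn_ge0 // invr_ge0 ltW.
have power n : (0 < n)%N -> n%:R ^+ d <= c * P.[n%:R].
  move=> n_gt0; have x_ge1 := natge1 n n_gt0.
  have := lower _ x_ge1; have := posP n n_gt0; rewrite ler_norml exprS.
  have : 0 < n%:R ^+ d :> R by rewrite exprn_gt0 // ltr0n.
  have Xd_ge0 : 0 <= X ^+ d by rewrite exprn_ge0.
  move: n%:R x_ge1 => x x_ge1 y_gt0 P_ge /andP[le_xp _].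
  have P_gt0 : 0 < P.[x] by lra.
  rewrite /c mulrDl; have [le_X|lt_X] := leP X x.
    rewrite -[X in X <= _]addr0 lerD //; last by rewrite !mulr_ge0 // ltW.
    rewrite mulrAC ler_pdivlMr //.
    have : 2 * A <= lc * x by move: le_X; rewrite /X ler_pdivrMr // [x * _]mulrC.
    move: (x ^+ d) y_gt0 le_xp => y y_gt0 le_xp le_A.
    have : 2 * A * y <= lc * x * y by rewrite ler_wpM2r // ltW.
    have x_gt0 : 0 < x by lra.
    move=> le_Ay; rewrite -(ler_pM2l x_gt0); lra.
  rewrite -[X in X <= _]add0r lerD //.
    by rewrite !mulr_ge0 ?invr_ge0 // ltW.
  have : x ^+ d <= X ^+ d.
    by apply: lerXn2r; rewrite ?nnegrE ?(ltW lt_X) //; lra.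
  move: (x ^+ d) (X ^+ d) Xd_ge0 => y z z_ge0 le_yz.
  have : z <= z * (2 * P.[x]) by rewrite ler_peMr.
  lra.
exists (A * k%:R ^+ d * c); first by rewrite !mulr_ge0 ?exprn_ge0.
move=> m n m_gt0 n_gt0 le_m; apply: le_trans (upper _ (natge1 m m_gt0)) _.
rewrite -!mulrA ler_wpM2l //.
apply: le_trans (_ : (k * n)%:R ^+ d <= _).
  by apply: lerXn2r; rewrite ?nnegrE // ler_nat.
by rewrite natrM exprMn ler_wpM2l ?exprn_ge0 // power.
Qed.

(** * The bound for all executions from the initial state *)

Theorem theorem6p29 (T : slp_times) (R : archiRealFieldType) (P : {poly R})
    (T_proper : proper_times T) (T_bound : slp_bound T P) :
  exists C : R, forall S : system,
    standard_form S -> (0 < system_size S)%N ->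
    forall (c : nat) (st : state), execution T (init S) c st ->
      c%:R <= C * ((system_size S)%:R ^+ 4 * P.[(system_size S)%:R ^+ 4]).
Proof.
have linP := slp_bound_linear T_proper T_bound.
(* With [b = 200 * N], the budget [18 * b] of a round is [q * N]. *)
pose q := (18 * 200)%N; have q_gt0 : (0 < q)%N by [].
move: (erefl q); rewrite {2}/q; move: q q_gt0 => q q_gt0 qE.
(* The SLPs have size at most [(1 + 2 * q ^ 4) * N ^ 4]; as [P] may fail to be monotone, this
   compares its value there, or at any smaller size, with that at [N ^ 4]. *)
have [C1 C1_ge0 scaleP] := poly_scale linP (1 + 2 * q ^ 4)%N.
pose d := (4 * q + 2 + 2 * q ^ 4)%N.
pose A1 := (2 * q * (d + 2 * q * d))%N.
pose A2 := (2 * q * (1 + 2 * q ^ 2 + q))%N.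
(* The first summand absorbs the overhead of order [N ^ 8] through [N ^ 4 <= 2 * p], the second the
   SLP operations through [t <= C1 * p]. *)
exists (A1%:R * 2 + A2%:R * C1) => S _ szS c st ex.
move E: (system_size S) szS => N N_gt0.
pose b := (200 * N)%N; have bE : (18 * b = q * N)%N by rewrite qE /b mulnA.
have N4_gt0 : (0 < N ^ 4)%N by rewrite expn_gt0 N_gt0.
rewrite -natrX; set p := P.[(N ^ 4)%:R].
have p_ge : (N ^ 4)%:R <= 2 * p by apply: linP.
have p_ge0 : 0 <= p.
  by have := le_trans (ler0n R (N ^ 4)) p_ge; rewrite pmulr_rge0.
pose t := Num.truncn (C1 * p).
have t_le : t%:R <= C1 * p by rewrite truncn_le mulr_ge0.
have le_t a : a%:R <= C1 * p -> (a <= t)%N by rewrite truncn_ge_nat // mulr_ge0.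
have time_le G i j : grammar_wf G -> (i < size G)%N -> (j < size G)%N ->
    (size G <= max_gram N b)%N ->
    [/\ t_concat T G i j <= t, t_equal T G i j <= t, t_prefix T G i j <= t,
        prefix (str G i) (str G j) -> t_suffix T G i j <= t
      & str G i <> str G j -> t_mismatch T G i j <= t]%N.
  move=> wf lt_i lt_j szG; have [] := T_bound G i j wf lt_i lt_j.
  have le_p : P.[(maxn (slp_size G i) (slp_size G j))%:R] <= C1 * p.
    apply: scaleP => //; first by rewrite leq_max slp_size_gt0.
    rewrite geq_max !(leq_trans (slp_size_le _ _)) //;
    exact: leq_trans szG (max_gram_le q_gt0 N_gt0 bE).
  move=> tc te tp ts tm; split=> [|||pre|neq]; apply: le_t;
    by [apply: le_trans le_p | apply: le_trans le_p; auto].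
have le_b : (200 * N <= b)%N by [].
have := execution_cost N_gt0 le_b time_le (init_inv b (esym E)) ex.
rewrite addn0 => le_c.
have {le_c} : (c <= A1 * (N ^ 4 * N ^ 4) + A2 * (N ^ 4 * t))%N.
  by apply: leq_trans le_c _; rewrite -expnD; apply: total_cost_le.
move: A1 A2 => {}A1 {}A2; rewrite -(ler_nat R) natrD.
rewrite (natrM _ A1) (natrM _ A2) (natrM _ _ (N ^ 4)) (natrM _ _ t).
move/le_trans; apply; rewrite mulrDl -!mulrA; apply: lerD.
  apply: ler_wpM2l => //; rewrite [2 * _]mulrCA; by apply: ler_wpM2l.
apply: ler_wpM2l => //; rewrite [C1 * _]mulrCA; by apply: ler_wpM2l.
Qed.
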